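(* The maps $\Delta$, $\epsilon$ (extended as algebra homomorphisms) and $S$ (extended as an algebra anti-homomorphism) given on generators by $$\Delta(\sigma_i^{\pm1})=\sigma_i^{\pm1}\otimes\sigma_i^{\pm1},\quad \Delta(\Theta(\pm\epsilon_i))=\Theta(\pm\epsilon_i)\otimes\Theta(\pm\epsilon_i)\ (i\in I),\quad \Delta(\tau_j)=\tau_j\otimes\tau_j\ (j\in I_1),$$ $$\Delta(\partial_i)=\partial_i\otimes\sigma_i^{-1}+\Theta(-\epsilon_i)\sigma_i\otimes\partial_i\ (i\in I_0),\qquad \Delta(\partial_j)=\partial_j\otimes1+\Theta(-\epsilon_j)\tau_j\otimes\partial_j\ (j\in I_1),$$ $$\epsilon(\sigma_i^{\pm1})=\epsilon(\Theta(\pm\epsilon_i))=\epsilon(\tau_j)=1,\qquad \epsilon(\partial_i)=0,$$ $$S(\sigma_i^{\pm1})=\sigma_i^{\mp1},\quad S(\Theta(\pm\epsilon_i))=\Theta(\mp\epsilon_i)\ (i\in I),\quad S(\tau_j)=\tau_j\ (j\in I_1),$$ $$S(\partial_i)=-q\,\Theta(\epsilon_i)\partial_i\ (i\in I_0),\qquad S(\partial_j)=-\Theta(\epsilon_j)\tau_j\partial_j\ (j\in I_1)$$ make $(\mathfrak D_q(m|n),\Delta,\epsilon,S)$ a pointed Hopf algebra.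
   Context: $\Bbbk$ is an algebraically closed field of characteristic zero, $q\in\Bbbk^\times$, $q\ne1$; $m,n\ge0$ are integers, $I_0=\{1,\dots,m\}$, $I_1=\{m+1,\dots,m+n\}$, $I=I_0\cup I_1$, $J=\{1,\dots,m+n-1\}$. For $a,b\in\mathbb Z^{m+n}$ put $a*b=\sum_{i>j}a_ib_j$; $\epsilon_i$ are the standard basis vectors. Set $\theta(\epsilon_i,\epsilon_j)=(-q)^{\epsilon_i*\epsilon_j-\epsilon_j*\epsilon_i}$ if $i,j\in I_1$, and $\theta(\epsilon_i,\epsilon_j)=q^{\epsilon_i*\epsilon_j-\epsilon_j*\epsilon_i}$ otherwise. Let $|\partial_i|=\bar0$ for $i\in I_0$ and $|\partial_i|=\bar1$ for $i\in I_1$. $\mathfrak D_q(m|n)$ is the associative $\Bbbk$-algebra generated by $\partial_i$, $\Theta(\pm\epsilon_i)$, $\sigma_i^{\pm1}$ $(i\in I)$, $\tau_j$ $(j\in I_1)$, with $\tau:=\prod_{j\in I_1}\tau_j$, subject to (whenever indices are in range): $\sigma_i\sigma_i^{-1}=1=\sigma_i^{-1}\sigma_i$, $\sigma_i\sigma_j=\sigma_j\sigma_i$ $(i,j\in I)$; $\tau^2=1=\tau_i^2$, $\tau_i\tau_j=\tau_j\tau_i$ $(i,j\in I_1)$, $\sigma_i\tau_j=\tau_j\sigma_i$ $(i\in I,j\in I_1)$; $\Theta(\epsilon_i)\Theta(-\epsilon_i)=1=\Theta(-\epsilon_i)\Theta(\epsilon_i)$, $\Theta(\epsilon_i)\Theta(\epsilon_j)=\Theta(\epsilon_i+\epsilon_j)=\Theta(\epsilon_j)\Theta(\epsilon_i)$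 (so that $\Theta(a)$ is the corresponding monomial for $a\in\mathbb Z^{m+n}$); $\sigma_j\Theta(\epsilon_i)=\Theta(\epsilon_i)\sigma_j$ $(i,j\in I)$, $\tau_j\Theta(\epsilon_i)=\Theta(\epsilon_i)\tau_j$ $(i\in I,j\in I_1)$; $\Theta(-\epsilon_m+\epsilon_{m+1})=\tau\sigma_m\sigma_{m+1}$, $\Theta(-\epsilon_i+\epsilon_{i+1})=\sigma_i\sigma_{i+1}$ $(m\ne i\in J)$; $\Theta(\epsilon_j)\partial_i\Theta(\epsilon_j)^{-1}=\theta(\epsilon_i,\epsilon_j)\partial_i$, $\sigma_j\partial_i\sigma_j^{-1}=(-1)^{\delta_{\bar1,|\partial_i|}\delta_{ij}}q^{-\delta_{ij}}\partial_i$ $(i,j\in I)$; $\tau_j\partial_i=(-1)^{\delta_{ij}}\partial_i\tau_j$ $(i\in I,j\in I_1)$; $\partial_i\partial_j=\theta(\epsilon_i,\epsilon_j)\partial_j\partial_i$ $(i,j\in I)$; $\partial_j^2=0$ $(j\in I_1)$. A Hopf algebra is pointed if all its simple subcoalgebras are one-dimensional. *)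

(* Defs.v *)
From HB Require Import structures.
From mathcomp Require Import all_boot all_algebra.
From mathcomp Require Import finmap monalg.
From mathcomp Require Import boolp classical_sets.

Set Implicit Arguments.
Unset Strict Implicit.
Unset Printing Implicit Defensive.

Import GRing.Theory.

Local Open Scope classical_set_scope.
Local Open Scope ring_scope.

Section LinearSpan.
Variables (k : fieldType) (V : lmodType k).

Inductive lspan (S : set V) : set V :=
| lspan0 : lspan S 0
| lspanZD (a : k) (x v : V) : S x -> lspan S v -> lspan S (a *: x + v).

Definition subspace (C : set V) : Prop :=
  C 0 /\ (forall (a : k) (x y : V), C x -> C y -> C (a *: x + y)).

Definition dim1 (C : set V) : Prop :=
  exists2 x : V, x != 0 & C = [set a *: x | a in [set: k]].

Lemma sub_lspan (S : set V) x : S x -> lspan S x.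
Proof. by move=> Sx; rewrite -[x]addr0 -[x]scale1r; apply: lspanZD (lspan0 _). Qed.

Lemma lspan_subspace (S : set V) : subspace (lspan S).
Proof.
split=> [|a x y Sx Sy]; first exact: lspan0.
elim: Sx => [|b z v Sz _ IH]; first by rewrite scaler0 add0r.
by rewrite scalerDr -addrA scalerA; apply: lspanZD.
Qed.

Definition lspan_pred (S : set V) : {pred V} := [pred v | `[< lspan S v >]].

Lemma lspan_pred_zmod S : zmod_closed (lspan_pred S).
Proof.
have [h0 hD] := lspan_subspace S; split; first exact/asboolP.
move=> x y /asboolP Sx /asboolP Sy; apply/asboolP.
by rewrite -scaleN1r addrC; apply: hD.
Qed.

HB.instance Definition _ S :=
  GRing.isZmodClosed.Build V (lspan_pred S) (lspan_pred_zmod S).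

(* V / span S *)
Definition modquot (S : set V) : Type :=
  Quotient.quot (lspan_pred S : zmodClosed V).

Section ModQuot.
Variable S : set V.

HB.instance Definition _ := GRing.Zmodule.on (modquot S).

Definition mqpi (x : V) : modquot S :=
  (\pi_(Quotient.quot (lspan_pred S : zmodClosed V)) x)%qT.
Definition mqrepr (x : modquot S) : V := repr x.

Lemma mqreprK : cancel mqrepr mqpi.
Proof. exact: reprK. Qed.

Lemma mqpi_eq x y : mqpi x = mqpi y <-> lspan S (x - y).
Proof.
split.
  by move/eqP; rewrite /mqpi -Quotient.idealrBE => /asboolP.
by move=> h; apply/eqP; rewrite /mqpi -Quotient.idealrBE; apply/asboolP.
Qed.

Lemma mqpi_zmod : zmod_morphism mqpi.
Proof. by move=> x y; apply: (@pi_is_zmod_morphism V _ 0 _). Qed.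

Lemma mqrepr_pi x : lspan S (mqrepr (mqpi x) - x).
Proof. by apply/mqpi_eq; rewrite mqreprK. Qed.

Lemma mqpiD x y : mqpi (x + y) = mqpi x + mqpi y.
Proof.
have h0 : mqpi 0 = 0 by rewrite -[0](subrr 0) mqpi_zmod subrr.
have hN z : mqpi (- z) = - mqpi z by rewrite -sub0r mqpi_zmod h0 sub0r.
by rewrite -{1}[y]opprK mqpi_zmod hN opprK.
Qed.

Lemma lspanZ a x : lspan S x -> lspan S (a *: x).
Proof.
move=> Sx; have [h0 hD] := lspan_subspace S.
by rewrite -[_ *: _]addr0; apply: hD.
Qed.

Definition mqscale (a : k) (x : modquot S) : modquot S := mqpi (a *: mqrepr x).

Lemma mqscale_pi a x : mqscale a (mqpi x) = mqpi (a *: x).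
Proof. by apply/mqpi_eq; rewrite -scalerBr; apply/lspanZ/mqrepr_pi. Qed.

Lemma mqscaleA a b x : mqscale a (mqscale b x) = mqscale (a * b) x.
Proof. by rewrite -[x]mqreprK !mqscale_pi scalerA. Qed.
Lemma mqscale1 : left_id 1 mqscale.
Proof. by move=> x; rewrite -[x]mqreprK mqscale_pi scale1r. Qed.
Lemma mqscaleDr : right_distributive mqscale +%R.
Proof.
move=> a x y; rewrite -[x]mqreprK -[y]mqreprK -mqpiD !mqscale_pi -mqpiD.
by rewrite scalerDr.
Qed.
Lemma mqscaleDl x : {morph mqscale^~ x : a b / a + b}.
Proof. by move=> a b; rewrite -[x]mqreprK !mqscale_pi -mqpiD scalerDl. Qed.

HB.instance Definition _ := GRing.Zmodule_isLmodule.Build k (modquot S)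
  mqscaleA mqscale1 mqscaleDr mqscaleDl.

Lemma mqpi_scalable : scalable mqpi.
Proof. by move=> a x; rewrite -mqscale_pi. Qed.

HB.instance Definition _ :=
  GRing.isZmodMorphism.Build V (modquot S) mqpi mqpi_zmod.
HB.instance Definition _ :=
  GRing.isScalable.Build k V (modquot S) *:%R mqpi mqpi_scalable.

End ModQuot.
End LinearSpan.

Section AlgQuotDef.
Variables (k : fieldType) (A : algType k) (S : set A).

(* The linear span of this set is the two-sided ideal generated by S, so that
   [algquot] is A modulo that ideal. *)
Definition two_sided : set A :=
  [set x | exists a s b, S s /\ x = a * s * b].

Definition algquot : Type := modquot two_sided.
HB.instance Definition _ := GRing.Lmodule.on algquot.

End AlgQuotDef.

(* Products, pure tensors and free generators are locked: comparing two of them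
   by unfolding is prohibitively slow. *)
HB.lock Definition aqmul (k : fieldType) (A : algType k) (S : set A)
    (x y : algquot S) : algquot S :=
  mqpi (two_sided S) (mqrepr x * mqrepr y).

Section AlgQuot.
Variables (k : fieldType) (A : algType k) (S : set A).
Local Notation two_sided := (two_sided S).
Local Notation algquot := (algquot S).
Local Notation aqmul := (@aqmul k A S).

Lemma ideal_mull (a x : A) : lspan two_sided x -> lspan two_sided (a * x).
Proof.
elim=> [|c y v [b [s [d [Ss ->]]]] _ IH]; first by rewrite mulr0; exact: lspan0.
rewrite mulrDr -scalerAr; apply: lspanZD IH.
by exists (a * b), s, d; rewrite !mulrA.
Qed.

Lemma ideal_mulr (a x : A) : lspan two_sided x -> lspan two_sided (x * a).
Proof.
elim=> [|c y v [b [s [d [Ss ->]]]] _ IH]; first by rewrite mul0r; exact: lspan0.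
rewrite mulrDl -scalerAl; apply: lspanZD IH.
by exists b, s, (d * a); rewrite !mulrA.
Qed.

Definition aqpi : A -> algquot := @mqpi k A two_sided.
HB.instance Definition _ := GRing.Linear.on aqpi.

Lemma aqmul_pi x y : aqmul (aqpi x) (aqpi y) = aqpi (x * y).
Proof.
rewrite aqmul.unlock; apply/mqpi_eq; set x' := mqrepr _; set y' := mqrepr _.
have -> : x' * y' - x * y = x' * (y' - y) + (x' - x) * y.
  by rewrite mulrBr mulrBl addrA subrK.
have [_ hD] := lspan_subspace two_sided.
rewrite -[x' * _]scale1r; apply: hD.
  by apply/ideal_mull/mqrepr_pi.
by apply/ideal_mulr/mqrepr_pi.
Qed.

Let aqK (x : algquot) : aqpi (mqrepr x) = x.
Proof. exact: mqreprK. Qed.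

Lemma aqmulA : associative aqmul.
Proof. by move=> x y z; rewrite -[x]aqK -[y]aqK -[z]aqK !aqmul_pi mulrA. Qed.
Lemma aqmul1l : left_id (aqpi 1) aqmul.
Proof. by move=> x; rewrite -[x]aqK aqmul_pi mul1r. Qed.
Lemma aqmul1r : right_id (aqpi 1) aqmul.
Proof. by move=> x; rewrite -[x]aqK aqmul_pi mulr1. Qed.
Lemma aqmulDl : left_distributive aqmul +%R.
Proof.
move=> x y z; rewrite -[x]aqK -[y]aqK -[z]aqK.
by rewrite -raddfD !aqmul_pi mulrDl raddfD.
Qed.
Lemma aqmulDr : right_distributive aqmul +%R.
Proof.
move=> x y z; rewrite -[x]aqK -[y]aqK -[z]aqK.
by rewrite -raddfD !aqmul_pi mulrDr raddfD.
Qed.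

HB.instance Definition _ := GRing.Zmodule_isPzRing.Build algquot
  aqmulA aqmul1l aqmul1r aqmulDl aqmulDr.

Lemma aqpi_monoid : monoid_morphism aqpi.
Proof. by split=> // x y; rewrite -aqmul_pi. Qed.
HB.instance Definition _ := GRing.isMonoidMorphism.Build A algquot aqpi aqpi_monoid.

Let aqpiZ (a : k) (x : A) : aqpi (a *: x) = a *: aqpi x.
Proof. exact: mqpi_scalable. Qed.

Lemma aq_scalerAl (a : k) (x y : algquot) : a *: (x * y) = (a *: x) * y.
Proof.
rewrite -[x]aqK -[y]aqK -aqpiZ -!rmorphM -aqpiZ.
by rewrite scalerAl.
Qed.
Lemma aq_scalerAr (a : k) (x y : algquot) : a *: (x * y) = x * (a *: y).
Proof.
rewrite -[x]aqK -[y]aqK -aqpiZ -!rmorphM -aqpiZ.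
by rewrite scalerAr.
Qed.

End AlgQuot.

Section TensorDef.
Variables (k : fieldType) (U V : lmodType k).

Definition bilinear_rels : set {malg k[(U * V)%type]} := [set x |
  (exists (a : k) u u' v,
     x = << (a *: u + u', v) >> - (a *: << (u, v) >> + << (u', v) >>)) \/
  (exists (a : k) u v v',
     x = << (u, a *: v + v') >> - (a *: << (u, v) >> + << (u, v') >>))].

Definition tensor : Type := modquot bilinear_rels.
HB.instance Definition _ := GRing.Lmodule.on tensor.

End TensorDef.

HB.lock Definition tens (k : fieldType) (U V : lmodType k) (u : U) (v : V) :
  tensor U V := mqpi (@bilinear_rels k U V) << (u, v) >>.
Arguments tens {k U V} u v.
Canonical tens_unlockable := Unlockable tens.unlock.

Section Tensor.
Variables (k : fieldType) (U V : lmodType k).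
Local Notation bilinear_rels := (@bilinear_rels k U V).
Local Notation tensor := (tensor U V).
Local Notation tens := (@tens k U V).

Definition bilin (W : lmodType k) (f : U -> V -> W) : Prop :=
  (forall v, linear (f^~ v)) /\ (forall u, linear (f u)).

Lemma tens_bilin : bilin tens.
Proof.
split=> [v a u u'|u a v v']; rewrite unlock -linearP; apply/mqpi_eq/sub_lspan.
  by left; exists a, u, u', v.
by right; exists a, u, v, v'.
Qed.

(* For bilinear f, the linear map with u (x) v |-> f u v (see [tliftE] and
   [tlift_linear]); meaningless otherwise, as it depends on the representative. *)
Definition tlift (W : lmodType k) (f : U -> V -> W) (t : tensor) : W :=
  \sum_(p <- msupp (mqrepr t)) (mqrepr t)@_p *: f p.1 p.2.

Section Lift.
Variables (W : lmodType k).
Implicit Types f g : U -> V -> W.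

Let ev f (x : {malg k[(U * V)%type]}) : W :=
  \sum_(p <- msupp x) x@_p *: f p.1 p.2.

Let evw f (E : {fset U * V}) x : (msupp x `<=` E)%fset ->
  ev f x = \sum_(p <- E) x@_p *: f p.1 p.2.
Proof.
move=> le; rewrite [LHS](big_fset_incl _ le) => //= p _ /mcoeff_outdom ->.
by rewrite scale0r.
Qed.

Let evP f : linear (ev f).
Proof.
move=> a x y; pose E := (msupp x `|` msupp y `|` msupp (a *: x + y))%fset.
have Ez : (msupp (a *: x + y) `<=` E)%fset by exact: fsubsetUr.
have Ex : (msupp x `<=` E)%fset by rewrite /E -fsetUA fsubsetUl.
have Ey : (msupp y `<=` E)%fset by rewrite /E fsetUAC fsubsetUr.
rewrite (evw f Ez) (evw f Ex) (evw f Ey).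
rewrite scaler_sumr -big_split; apply: eq_bigr => p _ /=.
by rewrite mcoeffD mcoeffZ scalerDl scalerA.
Qed.

Let evU f p : ev f << p >> = f p.1 p.2.
Proof.
by rewrite (evw f (E := [fset p]%fset)) ?msuppU_le // big_seq_fset1 mcoeffUU scale1r.
Qed.

Let ev_lspan f : bilin f -> forall x, lspan bilinear_rels x -> ev f x = 0.
Proof.
move=> [fl fr] x; have e0 : ev f 0 = 0 by rewrite /ev msupp0 big_seq_fset0.
have eN y : ev f (- y) = - ev f y.
  by rewrite -[- y]scaleN1r -[-1 *: y]addr0 evP e0 addr0 scaleN1r.
have eD y z : ev f (y + z) = ev f y + ev f z.
  by rewrite -{1}[y]scale1r evP scale1r.
elim=> [//|c y v Sy _ IH]; rewrite evP IH addr0.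
case: Sy => [[a [u [u' [w ->]]]]|[a [u [w [w' ->]]]]];
  by rewrite eD eN evP !evU /= ?fl ?fr subrr scaler0.
Qed.

Let tlift_pi f : bilin f -> forall x, tlift f (mqpi _ x) = ev f x.
Proof.
move=> fb x; rewrite -[LHS]/(ev f _); apply/eqP; rewrite -subr_eq0; apply/eqP.
have -> (y z : {malg k[(U * V)%type]}) : ev f y - ev f z = ev f (y - z).
  by rewrite [y - z]addrC -[- z]scaleN1r evP scaleN1r addrC.
exact/(ev_lspan fb)/mqrepr_pi.
Qed.

Lemma tliftE f : bilin f -> forall u v, tlift f (tens u v) = f u v.
Proof. by move=> fb u v; rewrite unlock tlift_pi ?evU. Qed.

Lemma tlift_linear f : bilin f -> linear (tlift f).
Proof.
move=> fb a x y; rewrite -[x]mqreprK -[y]mqreprK -linearP !tlift_pi //.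
exact: evP.
Qed.

Lemma tliftP a f g t :
  tlift (fun u v => a *: f u v + g u v) t = a *: tlift f t + tlift g t.
Proof.
rewrite /tlift scaler_sumr -big_split; apply: eq_bigr => p _ /=.
by rewrite scalerDr !scalerA mulrC.
Qed.

Lemma eq_tlift f g : f =2 g -> tlift f =1 tlift g.
Proof. by move=> fg t; apply: eq_bigr => p _; rewrite fg. Qed.

End Lift.

Lemma tensor_ind (P : tensor -> Prop) :
  P 0 -> (forall u v, P (tens u v)) ->
  (forall a x y, P x -> P y -> P (a *: x + y)) -> forall t, P t.
Proof.
move=> P0 + PD t; rewrite tens.unlock => Pt.
rewrite -[t]mqreprK [mqrepr t]monalgE raddf_sum.
apply: big_ind => // [x y Px Py|[u v] _].
  by rewrite -[x]scale1r; apply: PD.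
rewrite -[X in P X]addr0.
have -> (c : k) p : << c *g p >> = c *: << p >> :> {malg k[(U * V)%type]}.
  by apply/malgP => q; rewrite mcoeffZ !mcoeffU -[LHS]mulr_natr.
by have := PD ((mqrepr t)@_(u, v)) _ _ (Pt u v) P0; rewrite -mqpi_scalable.
Qed.

Lemma tensor_ext (W : lmodType k) (f g : tensor -> W) : linear f -> linear g ->
  (forall u v, f (tens u v) = g (tens u v)) -> f =1 g.
Proof.
move=> fl gl fg; elim/tensor_ind => [|//|a x y fx fy]; last by rewrite fl gl fx fy.
have h0 (h : tensor -> W) : linear h -> h 0 = 0.
  by move=> hl; rewrite -[0 in LHS](addNr 0) -[- 0]scaleN1r hl scaleN1r addNr.
by rewrite !h0.
Qed.

End Tensor.

Definition tmap (k : fieldType) (U V U' V' : lmodType k)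
    (f : U -> U') (g : V -> V') : tensor U V -> tensor U' V' :=
  tlift (fun u v => tens (f u) (g v)).

Definition tassoc (k : fieldType) (U V W : lmodType k) :
    tensor (tensor U V) W -> tensor U (tensor V W) :=
  tlift (fun t w => tlift (fun u v => tens u (tens v w)) t).

HB.lock Definition tmul (k : fieldType) (A B : algType k)
    (x y : tensor A B) : tensor A B :=
  tlift (fun a b => tlift (fun c d => tens (a * c) (b * d)) y) x.

Section TensorAlgebra.
Variables (k : fieldType) (A B : algType k).
Local Notation T := (tensor A B).
Local Notation tmul := (@tmul k A B).

Let bl : bilin (@tens k A B) := @tens_bilin k A B.

Let inner_bilin a b : bilin (fun c d => tens (a * c) (b * d) : T).
Proof.
split=> [d e c c'|c e d d']; rewrite mulrDr -scalerAr.
  by have [-> _] := bl.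
by have [_ ->] := bl.
Qed.

Let outer_bilin y :
  bilin (fun a b => tlift (fun c d => tens (a * c) (b * d)) y : T).
Proof.
split=> [b e a a'|a e b b']; rewrite -tliftP; apply: eq_tlift => c d;
  rewrite mulrDl -scalerAl.
  by have [-> _] := bl.
by have [_ ->] := bl.
Qed.

Lemma tmul_tens a b c d : tmul (tens a b) (tens c d) = tens (a * c) (b * d).
Proof.
by rewrite tmul.unlock (tliftE (outer_bilin _)) (tliftE (inner_bilin _ _)).
Qed.

Lemma tmul_linl y : linear (tmul^~ y).
Proof. by rewrite tmul.unlock; exact: (tlift_linear (outer_bilin y)). Qed.

Lemma tmul_linr x : linear (tmul x).
Proof.
move=> e y z; rewrite tmul.unlock -tliftP; apply: eq_tlift => a b.
exact: (tlift_linear (inner_bilin a b)).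
Qed.

Let comp_linl (f : T -> T) y : linear f -> linear (fun x => tmul (f x) y).
Proof. by move=> fl a u v; rewrite fl tmul_linl. Qed.
Let comp_linr (f : T -> T) x : linear f -> linear (fun y => tmul x (f y)).
Proof. by move=> fl a u v; rewrite fl tmul_linr. Qed.
Let id_lin : linear (@id T). Proof. by []. Qed.

Lemma tmulA : associative tmul.
Proof.
move=> x y z; move: x; apply: tensor_ext => [||a a'].
- exact: tmul_linl.
- by apply: comp_linl; exact: tmul_linl.
move: y; apply: tensor_ext => [||b b'].
- by apply: comp_linr; exact: tmul_linl.
- by apply: comp_linl; exact: tmul_linr.
move: z; apply: tensor_ext => [||c c'].
- by apply: comp_linr; exact: tmul_linr.
- exact: tmul_linr.
by rewrite !tmul_tens !mulrA.
Qed.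

Lemma tmul1l : left_id (tens 1 1) tmul.
Proof.
apply: tensor_ext => [||a b]; [exact: tmul_linr|exact: id_lin|].
by rewrite tmul_tens !mul1r.
Qed.

Lemma tmul1r : right_id (tens 1 1) tmul.
Proof.
apply: tensor_ext => [||a b]; [exact: tmul_linl|exact: id_lin|].
by rewrite tmul_tens !mulr1.
Qed.

Lemma tmulDl : left_distributive tmul +%R.
Proof. by move=> x y z; rewrite -[x in LHS]scale1r tmul_linl scale1r. Qed.

Lemma tmulDr : right_distributive tmul +%R.
Proof. by move=> x y z; rewrite -[y in LHS]scale1r tmul_linr scale1r. Qed.

HB.instance Definition _ := GRing.Zmodule_isPzRing.Build (tensor A B)
  tmulA tmul1l tmul1r tmulDl tmulDr.

End TensorAlgebra.

Section Hopf.
Variables (k : fieldType) (H : algType k).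

Record hopf_algebra (D : {lrmorphism H -> tensor H H})
    (e : {lrmorphism H -> k^o}) (S : {linear H -> H}) : Prop := HopfAlgebra {
  hopf_coassoc : forall h, tassoc (tmap D idfun (D h)) = tmap idfun D (D h);
  (* the canonical isomorphisms of k (x) H and H (x) k with H are built in *)
  hopf_counitl : forall h, tlift (fun a b => (e a : k) *: b) (D h) = h;
  hopf_counitr : forall h, tlift (fun a b => (e b : k) *: a) (D h) = h;
  hopf_antipodel : forall h, tlift (fun a b => S a * b) (D h) = (e h : k)%:A;
  hopf_antipoder : forall h, tlift (fun a b => a * S b) (D h) = (e h : k)%:A
}.

Variable D : H -> tensor H H.

(* The span below is the image of C (x) C in H (x) H. *)
Definition subcoalgebra (C : set H) : Prop :=
  subspace C /\
  forall c, C c ->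
    lspan [set t | exists a b, [/\ C a, C b & t = tens a b]] (D c).

Definition simple_subcoalgebra (C : set H) : Prop :=
  [/\ subcoalgebra C, C <> [set 0] &
      forall C', subcoalgebra C' -> C' `<=` C -> C' = [set 0] \/ C' = C].

Definition pointed : Prop := forall C, simple_subcoalgebra C -> dim1 C.

End Hopf.

Definition freealg (k : fieldType) (X : choiceType) : Type :=
  {malg k[{fmonom X}]}.
HB.instance Definition _ (k : fieldType) (X : choiceType) :=
  GRing.Lalgebra.on (freealg k X).

HB.lock Definition fgen (k : fieldType) (X : choiceType) (x : X) :
  freealg k X := << fmu x >>.
Canonical fgen_unlockable := Unlockable fgen.unlock.

Section FreeAlgebra.
Variables (k : fieldType) (X : choiceType).
Local Notation freealg := (freealg k X).
Local Notation fgen := (@fgen k X).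

Lemma freealg_scalerAr (a : k) (x y : freealg) : a *: (x * y) = x * (a *: y).
Proof.
have comC (w : freealg) : w * (a%:MP : freealg) = a%:MP * w.
  rewrite [w]monalgE mulr_suml mulr_sumr; apply: eq_bigr => i _.
  by rewrite !malgM_def !fgmulUU mulm1 mul1m mulrC.
by rewrite -!mul_malgC mulrA -comC mulrA.
Qed.

HB.instance Definition _ :=
  GRing.Lalgebra_isAlgebra.Build k freealg freealg_scalerAr.

Section Eval.
Variables (f : X -> k).
Definition fmonom_eval (w : {fmonom X}) : k := \prod_(x <- w) f x.

Lemma fmonom_eval_mmorphism : mmorphism fmonom_eval.
Proof.
by split=> [u v|]; rewrite /fmonom_eval ?fmM ?fm1 ?big_cat ?big_nil.
Qed.
HB.instance Definition _ :=
  isMultiplicative.Build {fmonom X} k fmonom_eval fmonom_eval_mmorphism.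

Definition freealg_eval : freealg -> k := mmap idfun fmonom_eval.
HB.instance Definition _ := GRing.RMorphism.on freealg_eval.
HB.instance Definition _ := GRing.isScalable.Build k freealg k *%R freealg_eval
  (@mmap_is_linear _ _ _).

Lemma freealg_evalE x : freealg_eval (fgen x) = f x.
Proof. by rewrite /freealg_eval unlock mmapU mul1r /= /fmonom_eval fmU big_seq1. Qed.
End Eval.

End FreeAlgebra.

(* the form written a * b *)
Definition star (N : nat) (a b : 'rV[int]_N) : int :=
  \sum_(i < N) \sum_(j < N | (j < i)%N) a 0 i * b 0 j.

(* The index set I = I_0 U I_1 is 'I_(m + n), counted from 0, where I_0 and I_1
   are the images of [lshift n : 'I_m -> 'I_(m + n)] and
   [rshift m : 'I_n -> 'I_(m + n)]; thus i is odd iff m <= i.  The generators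
   tau_j, j in I_1, are indexed by 'I_n. *)
Definition theta (k : fieldType) (m n : nat) (q : k) (i j : 'I_(m + n)) : k :=
  let e (l : 'I_(m + n)) : 'rV[int]_(m + n) := delta_mx 0 l in
  (if (m <= i)%N && (m <= j)%N then - q else q)
    ^ (star (e i) (e j) - star (e j) (e i)).

(* [GThetaV i] and [GsigmaV i] stand for Theta(-epsilon_i) and sigma_i^-1. *)
Inductive Dgen (m n : nat) : Type :=
| Gpartial of 'I_(m + n)
| GTheta of 'I_(m + n)
| GThetaV of 'I_(m + n)
| Gsigma of 'I_(m + n)
| GsigmaV of 'I_(m + n)
| Gtau of 'I_n.

HB.instance Definition _ (m n : nat) := gen_eqMixin (Dgen m n).
HB.instance Definition _ (m n : nat) := gen_choiceMixin (Dgen m n).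

Section Dq.
Variables (k : fieldType) (m n : nat) (q : k).

Local Notation F := (freealg k (Dgen m n)).
Local Notation "∂ i" := (fgen k (Gpartial i)) (at level 9, i at level 8).
Local Notation "'Θ' i" := (fgen k (GTheta i)) (at level 9, i at level 8).
Local Notation "'Θ⁻' i" := (fgen k (GThetaV i)) (at level 9, i at level 8).
Local Notation "'σ' i" := (fgen k (Gsigma i)) (at level 9, i at level 8).
Local Notation "'σ⁻' i" := (fgen k (GsigmaV i)) (at level 9, i at level 8).
Local Notation "'τ' j" :=
  (fgen k (Gtau m j)) (at level 9, j at level 8).

Definition tauall : F := \prod_(j < n) τ j.

Inductive Drel : F -> F -> Prop :=
| rel_sigmaV i : Drel (σ i * σ⁻ i) 1
| rel_Vsigma i : Drel (σ⁻ i * σ i) 1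
| rel_sigmaC i j : Drel (σ i * σ j) (σ j * σ i)
| rel_tau2 : Drel (tauall * tauall) 1
| rel_tau_i2 i : Drel (τ i * τ i) 1
| rel_tauC i j : Drel (τ i * τ j) (τ j * τ i)
| rel_sigma_tau i j : Drel (σ i * τ j) (τ j * σ i)
| rel_ThetaV i : Drel (Θ i * Θ⁻ i) 1
| rel_VTheta i : Drel (Θ⁻ i * Θ i) 1
| rel_ThetaC i j : Drel (Θ i * Θ j) (Θ j * Θ i)
| rel_sigma_Theta i j : Drel (σ j * Θ i) (Θ i * σ j)
| rel_tau_Theta i j : Drel (τ j * Θ i) (Θ i * τ j)
  (* Theta(-epsilon_i + epsilon_i') is the monomial
     Theta(-epsilon_i) Theta(epsilon_i').  Since indices start at 0, the pair
     (last even, first odd) is the one with i' = m. *)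
| rel_Theta_root (i i' : 'I_(m + n)) : i' = i.+1 :> nat ->
    Drel (Θ⁻ i * Θ i') ((if i' == m :> nat then tauall else 1) * σ i * σ i')
| rel_Theta_partial i j :
    Drel (Θ j * ∂ i * Θ⁻ j) (theta q i j *: ∂ i)
| rel_sigma_partial i j :
    Drel (σ j * ∂ i * σ⁻ j)
         ((-1) ^+ ((m <= i)%N && (i == j)) * q ^- (i == j) *: ∂ i)
| rel_tau_partial i j :
    Drel (τ j * ∂ i) ((-1) ^+ (i == rshift m j) *: (∂ i * τ j))
| rel_partialC i j : Drel (∂ i * ∂ j) (theta q i j *: (∂ j * ∂ i))
| rel_partial2 j : Drel (∂ (rshift m j) * ∂ (rshift m j)) 0.

Definition Drelators : set F := [set z | exists x y, Drel x y /\ z = x - y].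

Definition Dq : Type := algquot Drelators.
HB.instance Definition _ := GRing.Lmodule.on Dq.
HB.instance Definition _ := GRing.PzRing.on Dq.

Let aug (g : Dgen m n) : k := if g is Gpartial _ then 0 else 1.
Let ev : F -> k := freealg_eval aug.

Let evM : {morph ev : x y / x * y}. Proof. exact: rmorphM. Qed.
Let ev1 : ev 1 = 1. Proof. exact: rmorph1. Qed.
Let ev0 : ev 0 = 0. Proof. exact: rmorph0. Qed.
Let evZ c w : ev (c *: w) = c * ev w. Proof. exact: mmap_is_linear. Qed.
Let evg g : ev (fgen k g) = aug g. Proof. exact: freealg_evalE. Qed.

Let ev_rel x y : Drel x y -> ev x = ev y.
Proof.
have evT : ev tauall = 1.
  apply: (big_ind (fun w => ev w = 1)) => [|u v eu ew|l _]; first exact: ev1.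
    by rewrite evM eu ew mulr1.
  by rewrite evg.
case=> [i|i|i j||i|i j|i j|i|i|i j|i j|i j|i i' _|i j|i j|i j|i j|j].
- by rewrite evM !evg ev1 mulr1.
- by rewrite evM !evg ev1 mulr1.
- by rewrite [LHS]evM [RHS]evM !evg.
- by rewrite evM evT ev1 mulr1.
- by rewrite evM !evg ev1 mulr1.
- by rewrite [LHS]evM [RHS]evM !evg.
- by rewrite [LHS]evM [RHS]evM !evg.
- by rewrite evM !evg ev1 mulr1.
- by rewrite evM !evg ev1 mulr1.
- by rewrite [LHS]evM [RHS]evM !evg.
- by rewrite [LHS]evM [RHS]evM !evg.
- by rewrite [LHS]evM [RHS]evM !evg.
- rewrite [LHS]evM [RHS]evM [X in _ = X * _]evM !evg.
  by case: ifP; rewrite ?evT ?ev1 !mulr1.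
- by rewrite evZ [LHS]evM [X in X * _ = _]evM !evg !(mulr0, mul0r).
- by rewrite evZ [LHS]evM [X in X * _ = _]evM !evg !(mulr0, mul0r).
- by rewrite evZ [LHS]evM [X in _ = _ * X]evM !evg !(mulr0, mul0r).
- by rewrite evZ [LHS]evM [X in _ = _ * X]evM !evg !(mulr0, mul0r).
- by rewrite evM !evg ev0 mulr0.
Qed.

Lemma Dq_neq0 : 1 != 0 :> Dq.
Proof.
apply/eqP => h1; have pi0 : aqpi Drelators 0 = 0 by exact: raddf0.
have /mqpi_eq : aqpi Drelators 1 = aqpi Drelators 0 by rewrite pi0 -h1.
rewrite subr0 => h.
suff evI x : lspan (two_sided Drelators) x -> ev x = 0.
  by have := evI _ h; rewrite ev1 => /eqP; rewrite oner_eq0.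
elim=> [|c y v [a [z [b [[s [t [rst ->]]] ->]]]] _ IH]; first exact: ev0.
have evD u w : ev (u + w) = ev u + ev w by exact: rmorphD.
have evB u w : ev (u - w) = ev u - ev w by exact: rmorphB.
by rewrite evD evZ !evM evB IH (ev_rel rst) subrr mulr0 mul0r mulr0 addr0.
Qed.

HB.instance Definition _ := GRing.PzSemiRing_isNonZero.Build Dq Dq_neq0.
HB.instance Definition _ :=
  GRing.Lmodule_isLalgebra.Build k Dq (@aq_scalerAl _ _ Drelators).
HB.instance Definition _ :=
  GRing.Lalgebra_isAlgebra.Build k Dq (@aq_scalerAr _ _ Drelators).

Definition dgen (g : Dgen m n) : Dq := aqpi Drelators (fgen k g).

Definition dpartial (i : 'I_(m + n)) : Dq := dgen (Gpartial i).
Definition dTheta (i : 'I_(m + n)) : Dq := dgen (GTheta i).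
Definition dThetaV (i : 'I_(m + n)) : Dq := dgen (GThetaV i).
Definition dsigma (i : 'I_(m + n)) : Dq := dgen (Gsigma i).
Definition dsigmaV (i : 'I_(m + n)) : Dq := dgen (GsigmaV i).
Definition dtau (j : 'I_n) : Dq := dgen (Gtau m j).

End Dq.

Arguments dpartial {k m n} q i.
Arguments dTheta {k m n} q i.
Arguments dThetaV {k m n} q i.
Arguments dsigma {k m n} q i.
Arguments dsigmaV {k m n} q i.
Arguments dtau {k} m {n} q j.

(* Main.v *)
Require Import Defs.
From HB Require Import structures.
From mathcomp Require Import all_boot all_algebra.
From mathcomp Require Import monalg.
From mathcomp Require Import boolp classical_sets.

(** The algebra is given by generators and relations, so a homomorphism out of
    it is a family of elements satisfying the relations ([Dq_lrmorphism]).  The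
    coproduct, the counit and the antipode are obtained this way, with targets
    the tensor square, the ground field and the opposite algebra.

    The generators Theta, sigma, tau generate a commutative group of grouplike
    elements, and every generator d_i is skew primitive,
      Delta d_i = d_i (x) g_i + h_i (x) d_i,
    with g_i, h_i in that group.  Since h_j d_i = theta(j, i) d_i h_j and
    g_j d_i = d_i g_j for i <> j, the mixed terms of Delta d_i Delta d_j match
    those of theta(i, j) Delta d_j Delta d_i ([skew_primitives_commute]); for
    odd j, h_j anticommutes with d_j, whence (Delta d_j)^2 = 0.  The antipode
    sends d_i to w_i d_i with w_i a multiple of an element of the group, and
    its relations are again commutations past the group.

    The elements at which a given Hopf axiom holds form a subalgebra, so the
    axioms only have to be checked on generators, where each is a short
    computation ([generated_hopf_algebra]).

    Pointedness holds for every bialgebra generated by grouplike and skew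
    primitive elements ([generated_pointed]).  A linear form f acts on H by
    h |-> h_1 f(h_2).  If f kills all grouplikes, this action is locally
    nilpotent: it shortens words in the skew primitive generators.  If a
    subcoalgebra C met the span of the grouplikes only in 0, one could choose
    such an f agreeing with the counit on C, and then f would act on C as the
    identity, so that C = 0.  Hence a nonzero C contains a nonzero combination
    of grouplikes; other linear forms isolate one of its terms, so C contains a
    grouplike g, and k g is a subcoalgebra, equal to C when C is simple. *)

Set Implicit Arguments.
Unset Strict Implicit.
Unset Printing Implicit Defensive.

Import GRing.Theory.

Local Open Scope classical_set_scope.
Local Open Scope ring_scope.

(** * Subspaces and linear forms *)

Section Subspaces.
Variables (k : fieldType) (V : lmodType k).
Implicit Types C M : set V.

Lemma subspaceZ C a x : subspace C -> C x -> C (a *: x).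
Proof. by move=> [C0 CP] Cx; rewrite -[_ *: _]addr0; apply: CP. Qed.

Lemma subspaceD C x y : subspace C -> C x -> C y -> C (x + y).
Proof. by move=> [_ CP] Cx Cy; rewrite -[x]scale1r; apply: CP. Qed.

Lemma subspaceB C x y : subspace C -> C x -> C y -> C (x - y).
Proof. by move=> [_ CP] Cx Cy; rewrite -scaleN1r addrC; apply: CP. Qed.

Lemma lspan_sub C (S : set V) : subspace C -> S `<=` C -> lspan S `<=` C.
Proof. by move=> [C0 CP] SC v; elim=> // a x w /SC Cx _ Cw; apply: CP. Qed.

Lemma subspace_preimage (W : lmodType k) (f : V -> W) (C : set W) :
  linear f -> subspace C -> subspace [set v | C (f v)].
Proof.
move=> fl [C0 CP]; split=> /= [|a x y Cx Cy]; last by rewrite fl; apply: CP.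
have -> : 0 = 0 - 0 :> V by rewrite subrr.
by rewrite -scaleN1r addrC fl scaleN1r addNr.
Qed.

(** Zorn's lemma for the subspaces avoiding x.  When y lies outside a maximal M,
    the subspace M + k y contains x, which expresses y modulo M as a multiple
    of x; so x spans a complement of M. *)
Lemma maximal_subspace_avoiding C x : subspace C -> ~ C x ->
  exists M, [/\ subspace M, C `<=` M, ~ M x &
    forall y, exists a, M (y - a *: x)].
Proof.
move=> Csub Cx.
pose P A := subspace (C `|` A) /\ ~ (C `|` A) x.
(* The empty chain has an empty union; stating P on C `|` A makes it qualify. *)
have [F FP Ftot|A [[Asub Ax] Amax]] := @Zorn_bigcup V P.
  split; last by move=> [//|[X /FP[_ nX] Xx]]; apply: nX; right.
  have FF y z : (C `|` \bigcup_(X in F) X) y -> (C `|` \bigcup_(X in F) X) z ->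
      (C y /\ C z) \/ exists2 X, F X & (C `|` X) y /\ (C `|` X) z.
    move=> [Cy|[X FX Xy]] [Cz|[Y FY Yz]]; first by left.
    - by right; exists Y => //; split; [left|right].
    - by right; exists X => //; split; [right|left].
    - right; have [XY|YX] := Ftot _ _ FX FY.
        by exists Y => //; split; right => //; apply: XY.
      by exists X => //; split; right => //; apply: YX.
  split=> [|a y z]; first by left; case: Csub.
  move=> Uy Uz; case: (FF _ _ Uy Uz) => [[Cy Cz]|[X FX [Xy Xz]]].
    by left; case: Csub => _; apply.
  have [[_ XP] _] := FP _ FX.
  by case: (XP a _ _ Xy Xz) => [|Xv]; [left|right; exists X].
set M := C `|` A in Asub Ax; exists M; split=> // [y My|y]; first by left.
have [My|nMy] := pselect (M y); first by exists 0; rewrite scale0r subr0.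
pose B := [set v | exists a, M (v - a *: y)].
have MB : M `<=` B by move=> v Mv; exists 0; rewrite scale0r subr0.
have By : B y by exists 1; rewrite scale1r subrr; case: Asub.
have CB : C `|` B = B.
  by apply/seteqP; split=> [v [Cv|//]|v]; [apply: MB; left|right].
have Bsub : subspace B.
  split=> [|c u v [a Mu] [b Mv]]; first by apply: MB; case: Asub.
  exists (c * a + b).
  have -> : c *: u + v - (c * a + b) *: y = c *: (u - a *: y) + (v - b *: y).
    by rewrite scalerDl scalerBr scalerA opprD addrACA.
  by case: Asub => _; apply.
have : ~ P B.
  apply: Amax; split=> [v Av|BA]; first by apply: MB; right.
  by apply: nMy; right; apply: BA.
rewrite /P CB => nPB; have [a Mxy] : B x by apply: contrapT => nB; apply: nPB.
have [a0|a0] := eqVneq a 0; first by case: Ax; rewrite a0 scale0r subr0 in Mxy.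
exists a^-1; have -> : y - a^-1 *: x = - a^-1 *: (x - a *: y).
  by rewrite scalerBr scalerA mulNr mulVf // scaleN1r opprK scaleNr addrC.
exact: subspaceZ.
Qed.

(** The coordinate along x in the decomposition of V as M + k x. *)
Lemma separating_functional C x : subspace C -> ~ C x ->
  exists f : V -> k^o, [/\ linear f, forall y, C y -> f y = 0 & f x = 1].
Proof.
move=> Csub Cx; have [M [Msub CM nMx /choice[f fP]]] :=
  maximal_subspace_avoiding Csub Cx.
have fE y a : M (y - a *: x) -> f y = a.
  move=> My; apply/eqP; rewrite -subr_eq0; apply/negPn/negP => fa.
  apply: nMx; rewrite -[x]scale1r -(mulVf fa) -scalerA; apply: subspaceZ => //.
  have -> : (f y - a) *: x = (y - a *: x) - (y - f y *: x).
    by rewrite opprB [RHS]addrC addrA subrK scalerBl.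
  exact: subspaceB.
exists f; split=> [a u v|y /CM My|]; apply: fE.
- have -> : a *: u + v - (a * f u + f v) *: x =
      a *: (u - f u *: x) + (v - f v *: x).
    by rewrite scalerDl scalerBr scalerA opprD addrACA.
  by case: Msub => _; apply.
- by rewrite scale0r subr0.
- by rewrite scale1r subrr; case: Msub.
Qed.

End Subspaces.

(** * Tensor products of algebras *)

Section TensorVectors.
Variables (k : fieldType) (U V : lmodType k).
Implicit Types (u : U) (v : V).

Lemma tensPl a u u' v : tens (a *: u + u') v = a *: tens u v + tens u' v.
Proof. by have [/(_ v) ->] := tens_bilin U V. Qed.

Lemma tensPr a u v v' : tens u (a *: v + v') = a *: tens u v + tens u v'.
Proof. by have [_ /(_ u) ->] := tens_bilin U V. Qed.

Lemma tens0l v : tens 0 v = 0 :> tensor U V.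
Proof. by rewrite -[0 in LHS](addNr 0) -scaleN1r tensPl scaleN1r addNr. Qed.

Lemma tens0r u : tens u 0 = 0 :> tensor U V.
Proof. by rewrite -[0 in LHS](addNr 0) -scaleN1r tensPr scaleN1r addNr. Qed.

Lemma tensZl a u v : tens (a *: u) v = a *: tens u v.
Proof. by rewrite -[a *: u]addr0 tensPl tens0l addr0. Qed.

Lemma tensZr a u v : tens u (a *: v) = a *: tens u v.
Proof. by rewrite -[a *: v]addr0 tensPr tens0r addr0. Qed.

Lemma tensDl u u' v : tens (u + u') v = tens u v + tens u' v.
Proof. by rewrite -[u in LHS]scale1r tensPl scale1r. Qed.

Lemma tensDr u v v' : tens u (v + v') = tens u v + tens u v'.
Proof. by rewrite -[v in LHS]scale1r tensPr scale1r. Qed.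

End TensorVectors.

Section LinearFunctions.
Variables (k : fieldType) (U V : lmodType k) (f : U -> V).
Hypothesis fl : linear f.

Lemma lin0 : f 0 = 0.
Proof. by rewrite -[0 in LHS](addNr 0) -scaleN1r fl scaleN1r addNr. Qed.
Lemma linD x y : f (x + y) = f x + f y.
Proof. by rewrite -[x in LHS]scale1r fl scale1r. Qed.
Lemma linZ a x : f (a *: x) = a *: f x.
Proof. by rewrite -[a *: x]addr0 fl lin0 addr0. Qed.

Lemma lin_comp (W : lmodType k) (g : V -> W) : linear g -> linear (g \o f).
Proof. by move=> gl a x y; rewrite /= fl gl. Qed.

End LinearFunctions.

Section TensorAlgebraStructure.
Variables (k : fieldType) (A B : algType k).

Lemma tensM a b c d :
  tens a b * tens c d = tens (a * c) (b * d) :> tensor A B.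
Proof. exact: tmul_tens. Qed.

(** Linear forms f and g with f 1 = g 1 = 1 give a form f (x) g on the tensor
    product that takes the value 1 at 1 (x) 1. *)
Lemma tens_oner_neq0 : 1 != 0 :> tensor A B.
Proof.
have sub0 (W : lmodType k) : subspace [set 0 : W].
  by split=> // a x y -> ->; rewrite scaler0 add0r.
have one0 (W : algType k) : ~ [set 0 : W] 1 by apply/eqP/oner_neq0.
have [f [fl _ f1]] := separating_functional (@sub0 A) (@one0 A).
have [g [gl _ g1]] := separating_functional (@sub0 B) (@one0 B).
have fg : bilin (fun a b => f a * g b : k^o).
  split=> [b c x y|a c x y].
    by rewrite fl mulrDl scalerAl.
  by rewrite gl mulrDr scalerAr.
apply/eqP => /(congr1 (tlift (fun a b => f a * g b : k^o))).
have -> : 1 = tens 1 1 :> tensor A B by [].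
rewrite (tliftE fg) f1 g1 mulr1 (lin0 (tlift_linear fg)).
by apply/eqP/oner_neq0.
Qed.

HB.instance Definition _ :=
  GRing.PzSemiRing_isNonZero.Build (tensor A B) tens_oner_neq0.

Lemma tens_scalerAl (a : k) (x y : tensor A B) : a *: (x * y) = (a *: x) * y.
Proof. by symmetry; exact: (linZ (tmul_linl y)). Qed.

HB.instance Definition _ :=
  GRing.Lmodule_isLalgebra.Build k (tensor A B) tens_scalerAl.

Lemma tens_scalerAr (a : k) (x y : tensor A B) : a *: (x * y) = x * (a *: y).
Proof. by symmetry; exact: (linZ (tmul_linr x)). Qed.

HB.instance Definition _ :=
  GRing.Lalgebra_isAlgebra.Build k (tensor A B) tens_scalerAr.

Lemma tensor1E : 1 = tens 1 1 :> tensor A B. Proof. by []. Qed.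

End TensorAlgebraStructure.

(** An algebra structure on the opposite ring turns antihomomorphisms into
    homomorphisms of algebras. *)
Section OppositeAlgebra.
Variables (k : fieldType) (A : algType k).

HB.instance Definition _ := GRing.Lmodule.on A^c.
HB.instance Definition _ := GRing.Lmodule_isLalgebra.Build k A^c
  (fun a u v => @scalerAr k A a v u).
HB.instance Definition _ := GRing.Lalgebra_isAlgebra.Build k A^c
  (fun a u v => @scalerAl k A a v u).

End OppositeAlgebra.

Section TensorMaps.
Variable k : fieldType.

Lemma mull_linear (A : algType k) (x : A) : linear (fun y => x * y).
Proof. by move=> a y z; rewrite mulrDr scalerAr. Qed.

Lemma tens_linear_l (U V : lmodType k) (v : V) : linear (fun u : U => tens u v).
Proof. by move=> a x y; rewrite tensPl. Qed.

Section Tmap.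
Variables (U V U' V' : lmodType k) (f : U -> U') (g : V -> V').
Hypotheses (fl : linear f) (gl : linear g).

Let tmap_bilin : bilin (fun u v => tens (f u) (g v)).
Proof. by split=> [v|u] a x y; rewrite ?fl ?gl ?tensPl ?tensPr. Qed.

Lemma tmapE u v : tmap f g (tens u v) = tens (f u) (g v).
Proof. exact: (tliftE tmap_bilin). Qed.

Lemma tmap_linear : linear (tmap f g).
Proof. exact: (tlift_linear tmap_bilin). Qed.
End Tmap.

Definition spanning (V : lmodType k) (G : set V) := forall x, lspan G x.

(** Multiplicativity is bilinear in the two arguments. *)
Lemma spanning_multiplicative (A T : algType k) (f : A -> T) (G : set A) :
    linear f -> spanning G ->
  (forall x y, G x -> G y -> f (x * y) = f x * f y) ->
  forall x y, f (x * y) = f x * f y.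
Proof.
move=> fl spanG fG x y; elim: (spanG x) => [|a u v Gu _ IHv].
  by rewrite mul0r (lin0 fl) mul0r.
rewrite mulrDl -scalerAl !fl IHv mulrDl -scalerAl; congr (_ *: _ + _).
elim: (spanG y) => [|b w z Gw _ IHz]; first by rewrite mulr0 (lin0 fl) mulr0.
by rewrite mulrDr -scalerAr !fl IHz mulrDr -scalerAr fG.
Qed.

Lemma pure_tensors_span (U V : lmodType k) :
  spanning [set t : tensor U V | exists u v, t = tens u v].
Proof.
have [S0 SP] := lspan_subspace [set t : tensor U V | exists u v, t = tens u v].
by elim/tensor_ind => // u v; apply: sub_lspan; exists u, v.
Qed.

Lemma pure_tensors3_span (U V W : lmodType k) :
  spanning [set t : tensor (tensor U V) W |
    exists u v w, t = tens (tens u v) w].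
Proof.
set S := (X in spanning X) => t.
apply: lspan_sub (pure_tensors_span t); first exact: lspan_subspace.
move=> _ [x [w ->]]; pose C := [set u : tensor U V | lspan S (tens u w)].
apply: (lspan_sub (C := C)) (pure_tensors_span x).
  exact: (subspace_preimage (tens_linear_l w) (lspan_subspace S)).
by move=> _ [u [v ->]]; apply: sub_lspan; exists u, v, w.
Qed.

Lemma tmapM (A B A' B' : algType k)
    (f : {lrmorphism A -> A'}) (g : {lrmorphism B -> B'}) :
  forall x y, tmap f g (x * y) = tmap f g x * tmap f g y.
Proof.
have fl : linear f by move=> a u v; rewrite linearP.
have gl : linear g by move=> a u v; rewrite linearP.
apply: (spanning_multiplicative (tmap_linear fl gl) (@pure_tensors_span A B)).
by move=> _ _ [a [b ->]] [c [d ->]]; rewrite !(tensM, tmapE) // !rmorphM.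
Qed.

Section Tassoc.
Variables U V W : lmodType k.

Let inner_bilin (w : W) : bilin (fun (u : U) (v : V) => tens u (tens v w)).
Proof. by split=> [v|u] a x y; rewrite ?tensPl ?tensPr. Qed.

Let outer_bilin : bilin (fun (t : tensor U V) (w : W) =>
  tlift (fun u v => tens u (tens v w)) t).
Proof.
split=> [w|t] a x y; first exact: (tlift_linear (inner_bilin w)).
by rewrite -tliftP; apply: eq_tlift => u v; rewrite !tensPr.
Qed.

Lemma tassocE (u : U) (v : V) (w : W) :
  tassoc (tens (tens u v) w) = tens u (tens v w).
Proof. by rewrite /tassoc (tliftE outer_bilin) (tliftE (inner_bilin w)). Qed.

Lemma tassoc_linear : linear (@tassoc k U V W).
Proof. exact: (tlift_linear outer_bilin). Qed.
End Tassoc.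

Lemma tassocM (A B C : algType k) :
  forall x y : tensor (tensor A B) C, tassoc (x * y) = tassoc x * tassoc y.
Proof.
apply: (spanning_multiplicative (@tassoc_linear A B C)
  (@pure_tensors3_span A B C)).
by move=> _ _ [a [b [c ->]]] [a' [b' [c' ->]]]; rewrite !(tensM, tassocE).
Qed.

End TensorMaps.

(** * Bialgebras generated by grouplike and skew primitive elements *)

Section GeneratedBialgebra.
Variables (k : fieldType) (H : algType k).

(** Left multiplications by elements of X, applied to 1, span H.  The form of an
    induction principle is the one in which generation is used. *)
Definition generated_by (X : set H) := forall P : set H, P 1 -> subspace P ->
  (forall x y, X x -> P y -> P (x * y)) -> forall y, P y.

Variables (D : {lrmorphism H -> tensor H H}) (e : {lrmorphism H -> k^o}).

Definition grouplike g := D g = tens g g /\ e g = 1.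

Definition skew_primitive d := exists g h,
  [/\ grouplike g, grouplike h, D d = tens d g + tens h d & e d = 0].

Let Dl : linear D. Proof. by move=> a x y; rewrite linearP. Qed.
Let idl : linear (@idfun H). Proof. by []. Qed.

Lemma equalizer_subspace (U V : lmodType k) (f g : U -> V) :
  linear f -> linear g -> subspace [set x | f x = g x].
Proof.
by move=> fl gl; split=> /= [|a x y fx fy]; rewrite ?lin0 // fl gl fx fy.
Qed.

Variable X : set H.
Hypothesis X_gen : generated_by X.
Hypothesis X_pointlike : forall x, X x -> grouplike x \/ skew_primitive x.

Section Coassociativity.
Let F1 (t : tensor H H) := tassoc (tmap D idfun t).
Let F2 (t : tensor H H) := tmap idfun D t.

Let F1l : linear F1.
Proof. exact: (lin_comp (tmap_linear Dl idl) (@tassoc_linear _ _ _ _)). Qed.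
Let F2l : linear F2. Proof. exact: (tmap_linear idl Dl). Qed.

Let F1E a b : F1 (tens a b) = tassoc (tens (D a) b).
Proof. by rewrite /F1 tmapE. Qed.
Let F2E a b : F2 (tens a b) = tens a (D b).
Proof. by rewrite /F2 tmapE. Qed.

(** Both sides are algebra homomorphisms from H. *)
Lemma generated_coassoc h : tassoc (tmap D idfun (D h)) = tmap idfun D (D h).
Proof.
move: h; apply: (X_gen (P := [set h | F1 (D h) = F2 (D h)]))
  => /= [||x y Xx IH].
- by rewrite rmorph1 tensor1E F1E F2E rmorph1 tensor1E tassocE.
- exact: (equalizer_subspace (lin_comp Dl F1l) (lin_comp Dl F2l)).
have {}Xx : F1 (D x) = F2 (D x).
  have [[Dx _]|[g [g' [[Dg _] [Dg' _] Dx _]]]] := X_pointlike Xx.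
    by rewrite Dx F1E F2E Dx tassocE.
  rewrite Dx (linD F1l) (linD F2l) !F1E !F2E Dx Dg Dg' tensDl tensDr.
  by rewrite (linD (@tassoc_linear _ _ _ _)) !tassocE addrA.
have F1M t t' : F1 (t * t') = F1 t * F1 t'.
  rewrite /F1 -tassocM; congr (tassoc _); exact: (@tmapM k _ _ _ _ D idfun).
have F2M t t' : F2 (t * t') = F2 t * F2 t' by exact: (@tmapM k _ _ _ _ idfun D).
by rewrite rmorphM F1M F2M Xx IH.
Qed.
End Coassociativity.

Section Counit.

Let El (t : tensor H H) : H := tlift (fun a b => (e a : k) *: b) t.
Let Er (t : tensor H H) : H := tlift (fun a b => (e b : k) *: a) t.

Let bil_l : bilin (fun a b : H => (e a : k) *: b).
Proof.
split=> [b|a] c x y; first by rewrite linearP scalerDl scalerA.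
by rewrite scalerDr !scalerA mulrC.
Qed.

Let bil_r : bilin (fun a b : H => (e b : k) *: a).
Proof.
split=> [b|a] c x y; last by rewrite linearP scalerDl scalerA.
by rewrite scalerDr !scalerA mulrC.
Qed.

Let Ell : linear El. Proof. exact: (tlift_linear bil_l). Qed.
Let Erl : linear Er. Proof. exact: (tlift_linear bil_r). Qed.
Let ElE a b : El (tens a b) = (e a : k) *: b. Proof. exact: (tliftE bil_l). Qed.
Let ErE a b : Er (tens a b) = (e b : k) *: a. Proof. exact: (tliftE bil_r). Qed.

Let ElM t t' : El (t * t') = El t * El t'.
Proof.
apply: (spanning_multiplicative Ell (@pure_tensors_span _ H H)) => {t t'}.
move=> _ _ [a [b ->]] [c [d ->]].
by rewrite tensM !ElE rmorphM -scalerAl -scalerAr scalerA.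
Qed.

Let ErM t t' : Er (t * t') = Er t * Er t'.
Proof.
apply: (spanning_multiplicative Erl (@pure_tensors_span _ H H)) => {t t'}.
move=> _ _ [a [b ->]] [c [d ->]].
by rewrite tensM !ErE rmorphM -scalerAl -scalerAr scalerA.
Qed.

Lemma generated_counitl h : tlift (fun a b => (e a : k) *: b) (D h) = h.
Proof.
move: h; apply: (X_gen (P := [set h | El (D h) = h])) => /= [||x y Xx IH].
- by rewrite rmorph1 tensor1E ElE rmorph1 scale1r.
- exact: (equalizer_subspace (lin_comp Dl Ell) idl).
suff Ex : El (D x) = x by rewrite rmorphM ElM Ex IH.
have [[Dx ex]|[g [h [_ [_ eh] Dx ex]]]] := X_pointlike Xx.
  by rewrite Dx ElE ex scale1r.
by rewrite Dx (linD Ell) !ElE ex eh scale0r add0r scale1r.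
Qed.

Lemma generated_counitr h : tlift (fun a b => (e b : k) *: a) (D h) = h.
Proof.
move: h; apply: (X_gen (P := [set h | Er (D h) = h])) => /= [||x y Xx IH].
- by rewrite rmorph1 tensor1E ErE rmorph1 scale1r.
- exact: (equalizer_subspace (lin_comp Dl Erl) idl).
suff Ex : Er (D x) = x by rewrite rmorphM ErM Ex IH.
have [[Dx ex]|[g [h [[_ eg] _ Dx ex]]]] := X_pointlike Xx.
  by rewrite Dx ErE ex scale1r.
by rewrite Dx (linD Erl) !ErE ex eg scale0r addr0 scale1r.
Qed.

End Counit.

Section Antipode.
Variable S : {linear H -> H}.
Hypotheses (S1 : S 1 = 1) (SM : forall x y, S (x * y) = S y * S x).

Let Al (t : tensor H H) : H := tlift (fun a b => S a * b) t.
Let Ar (t : tensor H H) : H := tlift (fun a b => a * S b) t.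

Let bil_l : bilin (fun a b : H => S a * b).
Proof.
split=> [b|a] c x y; first by rewrite linearP mulrDl scalerAl.
by rewrite mulrDr scalerAr.
Qed.

Let bil_r : bilin (fun a b : H => a * S b).
Proof.
split=> [b|a] c x y; last by rewrite linearP mulrDr scalerAr.
by rewrite mulrDl scalerAl.
Qed.

Let All : linear Al. Proof. exact: (tlift_linear bil_l). Qed.
Let Arl : linear Ar. Proof. exact: (tlift_linear bil_r). Qed.

Let AlE a b : Al (tens a b) = S a * b. Proof. exact: (tliftE bil_l). Qed.
Let ArE a b : Ar (tens a b) = a * S b. Proof. exact: (tliftE bil_r). Qed.

Lemma antipodel_tens a b : tlift (fun a b => S a * b) (tens a b) = S a * b.
Proof. exact: (tliftE bil_l). Qed.
Lemma antipoder_tens a b : tlift (fun a b => a * S b) (tens a b) = a * S b.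
Proof. exact: (tliftE bil_r). Qed.
Lemma antipodel_linear : linear (tlift (fun a b => S a * b)).
Proof. exact: (tlift_linear bil_l). Qed.
Lemma antipoder_linear : linear (tlift (fun a b => a * S b)).
Proof. exact: (tlift_linear bil_r). Qed.

Let counit_linear : linear (fun h => (e h : k)%:A : H).
Proof. by move=> a x y; rewrite linearP scalerDl scalerA. Qed.

(** In Sweedler notation,
    S(x_1 c) x_2 d = S(c) (S(x_1) x_2) d = eps(x) S(c) d. *)
Let AlM x t : Al (D x) = (e x : k)%:A -> Al (D x * t) = (e x : k) *: Al t.
Proof.
move=> Sx; move: t; apply: tensor_ext => [||c d].
- by move=> a u v; rewrite mulrDr -scalerAr All.
- by move=> a u v; rewrite All scalerDr !scalerA mulrC.
have AlMcd t : Al (t * tens c d) = S c * Al t * d.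
  move: t; apply: tensor_ext => [||a b].
  - by move=> a u v; rewrite mulrDl -scalerAl All.
  - by move=> a u v; rewrite All mulrDr mulrDl -scalerAr -scalerAl.
  by rewrite tensM !AlE SM !mulrA.
by rewrite AlMcd Sx AlE mulr_algr -scalerAl.
Qed.

(** Here the inner factor comes from y: x_1 (y_1 S(y_2)) S(x_2). *)
Let ArM x y : Ar (D y) = (e y : k)%:A -> Ar (D x * D y) = (e y : k) *: Ar (D x).
Proof.
move=> Sy; move: (D x); apply: tensor_ext => [||a b].
- by move=> c u v; rewrite mulrDl -scalerAl Arl.
- by move=> c u v; rewrite Arl scalerDr !scalerA mulrC.
have ArMab t : Ar (tens a b * t) = a * Ar t * S b.
  move: t; apply: tensor_ext => [||c d].
  - by move=> c u v; rewrite mulrDr -scalerAr Arl.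
  - by move=> c u v; rewrite Arl mulrDr mulrDl -scalerAr -scalerAl.
  by rewrite tensM !ArE SM !mulrA.
by rewrite ArMab Sy ArE mulr_algr -scalerAl.
Qed.

Lemma generated_antipodel :
    (forall x, X x -> tlift (fun a b => S a * b) (D x) = (e x : k)%:A) ->
  forall h, tlift (fun a b => S a * b) (D h) = (e h : k)%:A.
Proof.
move=> XS; apply: (X_gen (P := [set h | Al (D h) = (e h : k)%:A]))
  => /= [||x y Xx IH].
- by rewrite !rmorph1 tensor1E AlE S1 mulr1 scale1r.
- exact: (equalizer_subspace (lin_comp Dl All) counit_linear).
by rewrite !rmorphM (AlM _ (XS _ Xx)) IH scalerA.
Qed.

Lemma generated_antipoder :
    (forall x, X x -> tlift (fun a b => a * S b) (D x) = (e x : k)%:A) ->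
  forall h, tlift (fun a b => a * S b) (D h) = (e h : k)%:A.
Proof.
move=> XS; apply: (X_gen (P := [set h | Ar (D h) = (e h : k)%:A]))
  => /= [||x y Xx IH].
- by rewrite !rmorph1 tensor1E ArE S1 mulr1 scale1r.
- exact: (equalizer_subspace (lin_comp Dl Arl) counit_linear).
have Sx : Ar (D x) = (e x : k)%:A := XS _ Xx.
by rewrite !rmorphM (ArM _ IH) Sx scalerA mulrC.
Qed.

Theorem generated_hopf_algebra :
    (forall x, X x -> tlift (fun a b => S a * b) (D x) = (e x : k)%:A /\
                      tlift (fun a b => a * S b) (D x) = (e x : k)%:A) ->
  hopf_algebra D e S.
Proof.
move=> XS; split=> h.
- exact: generated_coassoc.
- exact: generated_counitl.
- exact: generated_counitr.
- by apply: generated_antipodel => x /XS[].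
- by apply: generated_antipoder => x /XS[].
Qed.

End Antipode.

(** * Pointedness *)

Section Pointed.

Let iterl (f : H -> H) n : linear f -> linear (iter n f).
Proof. by move=> fl a x y; elim: n => //= n ->; rewrite fl. Qed.

Definition contract (f : H -> k^o) (t : tensor H H) : H :=
  tlift (fun a b => (f b : k) *: a) t.

Let contract_bilin (f : H -> k^o) : linear f ->
  bilin (fun a b => (f b : k) *: a : H).
Proof.
move=> fl; split=> [b|a] c x y; last by rewrite fl scalerDl scalerA.
by rewrite scalerDr !scalerA mulrC.
Qed.

Lemma contract_linear f : linear f -> linear (contract f).
Proof. by move/contract_bilin/tlift_linear. Qed.

Lemma contract_tens f a b : linear f -> contract f (tens a b) = f b *: a.
Proof. by move/contract_bilin/tliftE/(_ a b). Qed.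

(** The hit action of the dual algebra on H, h |-> h_1 f(h_2). *)
Definition hit f h : H := contract f (D h).

Lemma hit_linear f : linear f -> linear (hit f).
Proof. by move=> fl; exact: (lin_comp Dl (contract_linear fl)). Qed.

Lemma subcoalgebra_hit C f : linear f -> subcoalgebra D C ->
  forall c, C c -> C (hit f c).
Proof.
move=> fl [Csub DC] c /DC; rewrite /hit.
apply: (lspan_sub (C := [set t | C (contract f t)])).
  exact: (subspace_preimage (contract_linear fl)).
move=> _ [a [b [Ca Cb ->]]] /=.
by rewrite contract_tens //; apply: subspaceZ.
Qed.

(** On C only the values of f on C matter, and the counit acts trivially. *)
Lemma hit_counit C f : linear f -> subcoalgebra D C ->
  (forall c, C c -> f c = e c) -> forall c, C c -> hit f c = c.
Proof.
move=> fl [Csub DC] fe c Cc; rewrite -[RHS]generated_counitr.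
have el : linear e by move=> a x y; rewrite linearP.
move: (DC _ Cc).
apply: (lspan_sub (C := [set t | contract f t = contract e t])).
  exact: (equalizer_subspace (contract_linear fl) (contract_linear el)).
by move=> _ [a [b [_ /fe fb ->]]] /=; rewrite !contract_tens // fb.
Qed.

(** The length counts the skew primitive factors only: it is the degree that the
    coproduct respects. *)
Inductive word : nat -> H -> Prop :=
| word1 : word 0 1
| word_grouplike n g x : grouplike g -> word n x -> word n (g * x)
| word_skew n d x : skew_primitive d -> word n x -> word n.+1 (d * x).

Lemma grouplikeM g h : grouplike g -> grouplike h -> grouplike (g * h).
Proof.
move=> [Dg eg] [Dh eh]; split; first by rewrite rmorphM /= Dg Dh tensM.
rewrite rmorphM /= eg eh; exact: mulr1.
Qed.

Lemma word0_grouplike x : word 0 x -> grouplike x.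
Proof.
suff: forall n x, word n x -> n = 0%N -> grouplike x by move=> H0 /H0; apply.
move=> {}x n; elim=> [||//] => [_|{}n g {}x Gg _ IH n0].
  by split; rewrite rmorph1.
by apply: grouplikeM => //; apply: IH.
Qed.

Definition word_tensors n : set (tensor H H) := [set t | exists i j a b,
  [/\ word i a, word j b, (i + j)%N = n & t = tens a b]].

(** Multiplying by a skew primitive raises the length of exactly one of the two
    tensor factors by one. *)
Lemma word_coproduct n x : word n x -> lspan (word_tensors n) (D x).
Proof.
have lW i := lspan_subspace (word_tensors i).
elim=> {n x} [|n g x [Dg eg] _ IH|n d x [g [h [[Dg eg] [Dh eh] Dd ed]]] _ IH].
- rewrite rmorph1; apply: sub_lspan; exists 0%N, 0%N, 1, 1.
  by split=> //; exact: word1.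
- rewrite rmorphM /= Dg; move: IH.
  apply: (lspan_sub (C := [set t | lspan (word_tensors n) (tens g g * t)])).
    exact: (subspace_preimage (mull_linear _)).
  move=> _ [i [j [a [b [wa wb ij ->]]]]]; rewrite /= tensM; apply: sub_lspan.
  by exists i, j, (g * a), (g * b); split=> //; apply: word_grouplike.
rewrite rmorphM /= Dd; move: IH.
apply: (lspan_sub (C := [set t |
  lspan (word_tensors n.+1) ((tens d g + tens h d) * t)])).
  exact: (subspace_preimage (mull_linear _)).
have sd : skew_primitive d by exists g, h.
move=> _ [i [j [a [b [wa wb ij ->]]]]].
rewrite /= mulrDl !tensM; apply: subspaceD => //; apply: sub_lspan.
  exists i.+1, j, (d * a), (g * b); split=> //; last by rewrite addSn ij.
    exact: word_skew.
  exact: word_grouplike.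
exists i, j.+1, (h * a), (d * b); split=> //; last by rewrite addnS ij.
  exact: word_grouplike.
exact: word_skew.
Qed.

Lemma words_span : spanning [set x | exists n, word n x].
Proof.
apply: X_gen.
- by apply: sub_lspan; exists 0%N; exact: word1.
- exact: lspan_subspace.
move=> x y Xx; set W := [set x | _].
apply: (lspan_sub (C := [set y | lspan W (x * y)])) y.
  exact: (subspace_preimage (mull_linear _) (lspan_subspace W)).
move=> y [n wy]; apply: sub_lspan.
have [Gx|Sx] := X_pointlike Xx; first by exists n; apply: word_grouplike.
by exists n.+1; apply: word_skew.
Qed.

(** Each term a (x) b of Delta x for a word x of length n either has b of length
    0, hence grouplike and killed by f, or has a of length less than n. *)
Lemma hit_nilpotent f : linear f -> (forall g, grouplike g -> f g = 0) ->
  forall x, exists N, iter N (hit f) x = 0.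
Proof.
move=> fl fG.
have Tl N : linear (iter N (hit f)) by exact: iterl (hit_linear fl).
have wordN n x : word n x -> forall N, (n < N)%N -> iter N (hit f) x = 0.
  elim/ltn_ind: n x => n IH x /word_coproduct Dx [//|N]; rewrite ltnS => nN.
  rewrite iterSr /hit -/(hit f); move: Dx.
  apply: (lspan_sub (C := [set t | iter N (hit f) (contract f t) = 0])).
    apply: (subspace_preimage (C := [set 0])); last first.
      by split=> // a u v -> ->; rewrite scaler0 add0r.
    exact: (lin_comp (contract_linear fl) (Tl N)).
  move=> _ [i [[|j] [a [b [wa wb ij ->]]]]]; rewrite /= contract_tens //.
    by rewrite (fG _ (word0_grouplike wb)) scale0r (lin0 (Tl N)).
  have lt_in : (i < n)%N by rewrite -ij addnS ltnS leq_addr.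
  by rewrite (linZ (Tl N)) (IH i) ?scaler0 // (leq_trans lt_in).
move=> x.
suff [N NP] : exists N, forall M, (N <= M)%N -> iter M (hit f) x = 0.
  by exists N; apply: NP.
elim: (words_span x) => [|a u v [n wu] _ [N NP]].
  by exists 0%N => M _; rewrite lin0.
exists (maxn n.+1 N) => M; rewrite geq_max => /andP[nM NM].
by rewrite Tl (wordN _ _ wu) // NP // scaler0 add0r.
Qed.

(** Suppose not.  Choose x in C with eps x = 1, and let K be the sum of the span
    of the grouplikes and of the kernel of the counit on C.  As C meets the
    first summand in 0 only, x is not in K, and a form f separating x from K
    kills the grouplikes and agrees with the counit on C.  It acts on x both
    nilpotently and trivially. *)
Lemma subcoalgebra_meets_grouplikes C : subcoalgebra D C -> C <> [set 0] ->
  exists c, [/\ C c, c != 0 & lspan grouplike c].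
Proof.
move=> Ccoalg Cn0; have [Csub DC] := Ccoalg; have [C0 CP] := Csub.
apply: contrapT => nC.
have CG0 c : C c -> lspan grouplike c -> c = 0.
  by move=> Cc Gc; apply/eqP/negPn/negP => c0; apply: nC; exists c.
have el : linear e by move=> a x y; rewrite linearP.
pose z (_ : H) : k^o := 0.
have zl : linear z by move=> a x y; rewrite scaler0 add0r.
have z_nil c : hit z c = 0.
  rewrite /hit; move: (D c); apply: tensor_ext => [||a b].
  - exact: contract_linear.
  - by move=> a x y; rewrite scaler0 add0r.
  - by rewrite contract_tens // scale0r.
(* Otherwise the counit vanishes on C, and C = 0 by the counit axiom. *)
have [x Cx ex] : exists2 x, C x & e x = 1.
  have [c Cc ec] : exists2 c, C c & e c != 0.
    apply: contrapT => ne; apply: Cn0; apply/seteqP.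
    split=> [c Cc|_ ->]; last by [].
    rewrite /= -[c](hit_counit zl Ccoalg _ Cc) ?z_nil // => b Cb.
    by symmetry; apply/eqP/negPn/negP => eb; apply: ne; exists b.
  exists ((e c : k)^-1 *: c); first exact: subspaceZ.
  by rewrite linearZ /=; exact: mulVf.
pose K := [set y | exists2 a, lspan grouplike a & C (y - a) /\ e (y - a) = 0].
have Gsub := lspan_subspace grouplike; have [G0 GP] := Gsub.
have Ksub : subspace K.
  split=> [|p y v [a Ga [Ca ea]] [b Gb [Cb eb]]].
    by exists 0 => //; rewrite subrr linear0.
  exists (p *: a + b); first exact: GP.
  have -> : p *: y + v - (p *: a + b) = p *: (y - a) + (v - b).
    by rewrite scalerBr opprD addrACA.
  by rewrite el ea eb scaler0 addr0; split=> //; exact: CP.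
have nKx : ~ K x.
  move=> [a Ga [Cxa exa]]; have a0 : a = 0.
    apply: CG0 => //; rewrite -[a](subKr x); exact: subspaceB.
  by move: exa; rewrite a0 subr0 ex; apply/eqP/oner_neq0.
have [f [fl fK fx]] := separating_functional Ksub nKx.
have fG g : grouplike g -> f g = 0.
  by move=> Gg; apply: fK; exists g; [exact: sub_lspan|rewrite subrr linear0].
have fe c : C c -> f c = e c.
  move=> Cc; have : K (c - (e c : k) *: x).
    exists 0 => //; rewrite subr0; split.
      by apply: subspaceB => //; exact: subspaceZ.
    rewrite -scaleN1r addrC el (linZ el) ex scaleN1r addrC; apply/eqP.
    by rewrite subr_eq0; apply/eqP; symmetry; exact: mulr1.
  move/fK; rewrite -scaleN1r addrC fl (linZ fl) fx scaleN1r addrC => /eqP.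
  by rewrite subr_eq0 => /eqP ->; exact: mulr1.
have [N xN] := hit_nilpotent fl fG x.
have Tx n : iter n (hit f) x = x.
  by elim: n => //= n ->; apply: hit_counit fl Ccoalg fe x Cx.
by move: ex; rewrite -(Tx N) xN linear0; apply/eqP; rewrite eq_sym oner_neq0.
Qed.

(** Induction on a list of grouplikes whose span contains the given element c of
    C.  If the head g depends on the tail, drop it; otherwise a form equal to 1
    at g and to 0 on the tail sends c = a g + c' to a g, which is thus in C. *)
Lemma subcoalgebra_has_grouplike C : subcoalgebra D C -> C <> [set 0] ->
  exists2 g, grouplike g & C g.
Proof.
move=> Ccoalg Cn0; have [Csub _] := Ccoalg; have [C0 CP] := Csub.
have [c [Cc c0 Gc]] := subcoalgebra_meets_grouplikes Ccoalg Cn0.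
have [s [sG sc]] : exists s : seq H,
    (forall g, g \in s -> grouplike g) /\ lspan [set` s] c.
  elim: Gc => [|a g v Gg _ [s [sG sv]]].
    by exists [::]; split=> //; exact: lspan0.
  exists (g :: s); split=> [h|]; first by rewrite inE => /predU1P[->//|/sG].
  apply: lspanZD; first by rewrite /= mem_head.
  move: sv; apply: lspan_sub; first exact: lspan_subspace.
  by move=> h sh; apply: sub_lspan; rewrite /= inE (sh : h \in s) orbT.
elim: s sG c Cc c0 {Gc} sc => [|g s IHs] sG c Cc c0 sc.
  case/eqP: c0; move: sc; apply: (lspan_sub (C := [set 0])) => //.
  by split=> // a u v -> ->; rewrite scaler0 add0r.
have Gg : grouplike g by apply: sG; exact: mem_head.
have {}sG h : h \in s -> grouplike h.
  by move=> sh; apply: sG; rewrite inE sh orbT.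
have Ssub := lspan_subspace [set` s].
have [a [c' sc' cE]] :
    exists a, exists2 c', lspan [set` s] c' & c = a *: g + c'.
  move: sc; apply: (lspan_sub (C := [set c | exists a, exists2 c',
    lspan [set` s] c' & c = a *: g + c'])) => [|h /=].
    split=> [|p _ _ [a [u su ->]] [b [v sv ->]]].
      by exists 0, 0; rewrite ?scale0r ?addr0 //; exact: lspan0.
    exists (p * a + b), (p *: u + v); first by case: Ssub => _; apply.
    by rewrite scalerDr scalerA scalerDl addrACA.
  rewrite inE => /predU1P[->|sh].
    by exists 1, 0; rewrite ?scale1r ?addr0 //; exact: lspan0.
  by exists 0, h; [exact: sub_lspan|rewrite scale0r add0r].
have [sg|nsg] := pselect (lspan [set` s] g).
  by apply: (IHs sG c) => //; rewrite cE; case: Ssub => _; apply.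
have [f [fl fs fg]] := separating_functional Ssub nsg.
have Tc : hit f c = a *: g.
  have Tl := hit_linear fl; rewrite cE Tl.
  have -> : hit f c' = 0.
    move: sc'.
    apply: (lspan_sub (C := [set v | hit f v = 0])) => [|h sh /=].
      apply: (subspace_preimage (C := [set 0])) => //.
      by split=> // p u v -> ->; rewrite scaler0 add0r.
    have [Dh _] := sG _ sh.
    by rewrite /hit Dh contract_tens // fs ?scale0r //; exact: sub_lspan.
  by have [Dg _] := Gg; rewrite addr0 /hit Dg contract_tens // fg scale1r.
have Cag : C (a *: g) by rewrite -Tc; exact: subcoalgebra_hit.
have [a0|a0] := eqVneq a 0.
  by apply: (IHs sG c) => //; rewrite cE a0 scale0r add0r.
exists g => //; rewrite -[g]scale1r -(mulVf a0) -scalerA; exact: subspaceZ.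
Qed.

(** The line through a grouplike in C is a subcoalgebra of C, hence all of C when
    C is simple. *)
Theorem generated_pointed : pointed D.
Proof.
move=> C [Ccoalg Cn0 Csimple]; have [Csub _] := Ccoalg.
have [g [Dg eg] Cg] := subcoalgebra_has_grouplike Ccoalg Cn0.
have g0 : g != 0.
  by apply/eqP => g0; move/eqP: eg; rewrite g0 linear0 eq_sym oner_eq0.
pose L := [set a *: g | a in [set: k]].
have Lcoalg : subcoalgebra D L.
  split=> [|_ [a _ <-]].
    split=> [|p _ _ [a _ <-] [b _ <-]]; first by exists 0; rewrite ?scale0r.
    by exists (p * a + b); rewrite ?scalerDl ?scalerA.
  rewrite linearZ /= Dg; apply/lspanZ/sub_lspan; exists g, g.
  by split=> //; exists 1; rewrite ?scale1r.
have LC : L `<=` C by move=> _ [a _ <-]; exact: subspaceZ.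
exists g => //; have [L0|<-//] := Csimple _ Lcoalg LC.
have : L g by exists 1; rewrite ?scale1r.
by rewrite L0 => /eqP; rewrite (negPf g0).
Qed.

End Pointed.

End GeneratedBialgebra.

(** * Universal property of the presented algebra *)

Section FreeAlgebraUniversal.
Variables (k : fieldType) (X : choiceType) (B : algType k) (f : X -> B).

Definition word_eval (w : {fmonom X}) : B := \prod_(x <- w) f x.

Lemma word_eval_mmorphism : mmorphism word_eval.
Proof.
by split=> [u v|]; rewrite /word_eval ?fmM ?fm1 ?big_cat ?big_nil.
Qed.
HB.instance Definition _ :=
  isMultiplicative.Build {fmonom X} B word_eval word_eval_mmorphism.

Definition free_lift : freealg k X -> B := mmap (in_alg B) word_eval.

Lemma free_liftZ c x : free_lift (c *: x) = c *: free_lift x.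
Proof. by rewrite /free_lift mmapZ /= mulr_algl. Qed.

Lemma free_lift_zmod : zmod_morphism free_lift.
Proof. exact: mmap_is_additive. Qed.

Lemma free_liftM x y : free_lift (x * y) = free_lift x * free_lift y.
Proof.
have [fM _] : multiplicative free_lift; last exact: fM.
apply: commr_mmap_is_multiplicative => g w w' /=.
by rewrite /GRing.comm mulr_algl mulr_algr.
Qed.

Lemma free_lift1 : free_lift 1 = 1.
Proof. exact: mmap1. Qed.

Lemma free_lift_gen x : free_lift (fgen k x) = f x.
Proof.
rewrite /free_lift unlock mmapU /= scale1r mul1r /word_eval.
by rewrite fmU big_seq1.
Qed.

End FreeAlgebraUniversal.

Lemma freealg_generated (k : fieldType) (X : choiceType) :
  generated_by [set x : freealg k X | exists g, x = fgen k g].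
Proof.
move=> P P1 Psub PM y; have [P0 PP] := Psub.
rewrite [y]monalgE; apply: big_ind => // [u v Pu Pv|w _].
  exact: subspaceD.
have -> : << y@_w *g w >> = y@_w *: << w >> :> freealg k X.
  by apply/malgP => v; rewrite mcoeffZ !mcoeffU -[LHS]mulr_natr.
apply: subspaceZ => //; case: w => w; elim: w => [|x w IH].
  by rewrite -(fmoneE X).
have -> : << FMonom (x :: w) >> = fgen k x * << FMonom w >> :> freealg k X.
  rewrite unlock malgM_def fgmulUU mulr1; congr (<< _ >>).
  by apply/eqP; rewrite fmP fmM fmU.
by apply: PM => //; exists x.
Qed.

Lemma twist_of_conj (k : fieldType) (A : algType k) (t t' d : A) c :
  t' * t = 1 -> t * d * t' = c *: d -> t * d = c *: (d * t).
Proof. by move=> t't tdt'; rewrite scalerAl -tdt' -[RHS]mulrA t't mulr1. Qed.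

Section DqUniversal.
Variables (k : fieldType) (m n : nat) (q : k).

(** The defining relations on a family of elements of an algebra.  The
    conjugations by Theta_j and sigma_j are written as commutations up to a
    scalar, which is equivalent as these elements are invertible, and which is
    the form in which d_i is moved past products of such elements. *)
Record Dq_relations (B : algType k) (f : Dgen m n -> B) : Prop := DqRelations {
  rel_sigmaVr : forall i, f (Gsigma i) * f (GsigmaV i) = 1;
  rel_sigmaVl : forall i, f (GsigmaV i) * f (Gsigma i) = 1;
  rel_ThetaVr : forall i, f (GTheta i) * f (GThetaV i) = 1;
  rel_ThetaVl : forall i, f (GThetaV i) * f (GTheta i) = 1;
  rel_tautau : forall j, f (Gtau m j) * f (Gtau m j) = 1;
  rel_tauprod2 : (\prod_j f (Gtau m j)) * (\prod_j f (Gtau m j)) = 1;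
  rel_sigma_sigma : forall i j,
    f (Gsigma i) * f (Gsigma j) = f (Gsigma j) * f (Gsigma i);
  rel_tau_tau : forall i j,
    f (Gtau m i) * f (Gtau m j) = f (Gtau m j) * f (Gtau m i);
  rel_Theta_Theta : forall i j,
    f (GTheta i) * f (GTheta j) = f (GTheta j) * f (GTheta i);
  rel_sigmatau : forall i j,
    f (Gsigma i) * f (Gtau m j) = f (Gtau m j) * f (Gsigma i);
  rel_sigmaTheta : forall i j,
    f (Gsigma j) * f (GTheta i) = f (GTheta i) * f (Gsigma j);
  rel_tauTheta : forall i j,
    f (Gtau m j) * f (GTheta i) = f (GTheta i) * f (Gtau m j);
  rel_root : forall i i' : 'I_(m + n), i' = i.+1 :> nat ->
    f (GThetaV i) * f (GTheta i') =
      (if i' == m :> nat then \prod_j f (Gtau m j) else 1)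
      * f (Gsigma i) * f (Gsigma i');
  rel_Theta_d : forall i j,
    f (GTheta j) * f (Gpartial i) =
      theta q i j *: (f (Gpartial i) * f (GTheta j));
  rel_sigma_d : forall i j,
    f (Gsigma j) * f (Gpartial i) =
      ((-1) ^+ ((m <= i)%N && (i == j)) * q ^- (i == j))
        *: (f (Gpartial i) * f (Gsigma j));
  rel_tau_d : forall i j,
    f (Gtau m j) * f (Gpartial i) =
      (-1) ^+ (i == rshift m j) *: (f (Gpartial i) * f (Gtau m j));
  rel_d_d : forall i j,
    f (Gpartial i) * f (Gpartial j) =
      theta q i j *: (f (Gpartial j) * f (Gpartial i));
  rel_d2 : forall j, f (Gpartial (rshift m j)) * f (Gpartial (rshift m j)) = 0
}.

Local Notation gen g := (fgen k g).

Section Lift.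
Variables (B : algType k) (f : Dgen m n -> B).
Hypothesis f_rel : Dq_relations f.

Let ev : freealg k (Dgen m n) -> B := free_lift f.
Let evM x y : ev (x * y) = ev x * ev y. Proof. exact: free_liftM. Qed.
Let ev1 : ev 1 = 1. Proof. exact: free_lift1. Qed.
Let evZ c x : ev (c *: x) = c *: ev x. Proof. exact: free_liftZ. Qed.
Let evg g : ev (gen g) = f g. Proof. exact: free_lift_gen. Qed.
Let evB x y : ev (x - y) = ev x - ev y. Proof. exact: free_lift_zmod. Qed.
Let ev0 : ev 0 = 0. Proof. by rewrite -[0 in LHS](subrr 0) evB subrr. Qed.
Let evD x y : ev (x + y) = ev x + ev y.
Proof. by rewrite -[y in LHS]opprK evB -[- y]sub0r evB ev0 sub0r opprK. Qed.
Let evT : ev (tauall k m n) = \prod_j f (Gtau m j).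
Proof.
by rewrite (big_morph ev evM ev1); apply: eq_bigr => j _; rewrite evg.
Qed.

Lemma free_lift_Drel x y : Drel q x y -> ev x = ev y.
Proof.
case: f_rel => sVr sVl TVr TVl tt tp ss tc TT st sT tT rt Td sd td dd d2.
case=> [i|i|i j||i|i j|i j|i|i|i j|i j|i j|i i' ii'|i j|i j|i j|i j|j].
- by rewrite evM !evg ev1.
- by rewrite evM !evg ev1.
- by rewrite [LHS]evM [RHS]evM !evg.
- by rewrite evM evT ev1.
- by rewrite evM !evg ev1.
- by rewrite [LHS]evM [RHS]evM !evg.
- by rewrite [LHS]evM [RHS]evM !evg.
- by rewrite evM !evg ev1.
- by rewrite evM !evg ev1.
- by rewrite [LHS]evM [RHS]evM !evg.
- by rewrite [LHS]evM [RHS]evM !evg.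
- by rewrite [LHS]evM [RHS]evM !evg.
- rewrite [LHS]evM [RHS]evM [X in _ = X * _]evM !evg rt //.
  by case: ifP => _; rewrite ?evT ?ev1.
- rewrite evZ [LHS]evM [X in X * _ = _]evM !evg.
  by rewrite Td -scalerAl -mulrA TVr mulr1.
- rewrite evZ [LHS]evM [X in X * _ = _]evM !evg.
  by rewrite sd -scalerAl -mulrA sVr mulr1.
- by rewrite evZ [LHS]evM [X in _ = _ *: X]evM !evg.
- by rewrite evZ [LHS]evM [X in _ = _ *: X]evM !evg.
- by rewrite evM !evg ev0.
Qed.

Lemma free_lift_ideal x : lspan (two_sided (Drelators q)) x -> ev x = 0.
Proof.
apply: (lspan_sub (C := [set x | ev x = 0])).
  by split=> /= [|a u v eu ew]; rewrite ?ev0 // evD evZ eu ew scaler0 addr0.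
move=> _ [a [_ [b [[u [v [uv ->]]] ->]]]] /=.
by rewrite !evM evB (free_lift_Drel uv) subrr mulr0 mul0r.
Qed.

(** Evaluation at a representative; independent of it by [free_lift_ideal]. *)
Definition Dq_lift (x : Dq m n q) : B := ev (mqrepr x).

Lemma Dq_lift_pi x : Dq_lift (aqpi (Drelators q) x) = ev x.
Proof.
apply/eqP; rewrite -subr_eq0 -evB; apply/eqP.
exact/free_lift_ideal/mqrepr_pi.
Qed.

Lemma Dq_lift_gen g : Dq_lift (dgen q g) = f g.
Proof. by rewrite Dq_lift_pi evg. Qed.

Let aqK (x : Dq m n q) : aqpi (Drelators q) (mqrepr x) = x.
Proof. exact: mqreprK. Qed.

Lemma Dq_lift_linear : linear Dq_lift.
Proof.
move=> a x y; rewrite -[x]aqK -[y]aqK.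
have -> : a *: aqpi (Drelators q) (mqrepr x) + aqpi (Drelators q) (mqrepr y) =
  aqpi (Drelators q) (a *: mqrepr x + mqrepr y) by rewrite linearP.
by rewrite !Dq_lift_pi evD evZ.
Qed.

Lemma Dq_lift_monoid : monoid_morphism Dq_lift.
Proof.
split=> [|x y]; first exact: etrans (Dq_lift_pi 1) ev1.
rewrite -[x]aqK -[y]aqK.
have -> : aqpi (Drelators q) (mqrepr x) * aqpi (Drelators q) (mqrepr y) =
  aqpi (Drelators q) (mqrepr x * mqrepr y) :> Dq m n q by rewrite rmorphM.
by rewrite !Dq_lift_pi evM.
Qed.

HB.instance Definition _ :=
  GRing.isLinear.Build k (Dq m n q) B *:%R Dq_lift Dq_lift_linear.
HB.instance Definition _ :=
  GRing.isMonoidMorphism.Build (Dq m n q) B Dq_lift Dq_lift_monoid.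

Definition Dq_lrmorphism : {lrmorphism Dq m n q -> B} := Dq_lift.

End Lift.

Lemma Dq_generated : generated_by (range (@dgen k m n q)).
Proof.
move=> P P1 Psub PM y; rewrite -[y]mqreprK.
pose pi x : Dq m n q := aqpi (Drelators q) x.
have pil : linear pi by move=> a u v; exact: (linearP (aqpi (Drelators q))).
apply: (freealg_generated (P := [set x | P (pi x)])) => //=.
  exact: (subspace_preimage pil).
move=> _ x [g ->] Px; have -> : pi (gen g * x) = dgen q g * pi x.
  exact: (rmorphM (aqpi (Drelators q))).
by apply: PM => //; exists g.
Qed.

Lemma dgen_relations : Dq_relations (@dgen k m n q).
Proof.
pose pi x : Dq m n q := aqpi (Drelators q) x.
have pi_rel x y : Drel q x y -> pi x = pi y.
  move=> xy; apply/mqpi_eq/sub_lspan; exists 1, (x - y), 1.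
  by split; [exists x, y|rewrite mul1r mulr1].
have pil : linear pi by move=> a u v; exact: (linearP (aqpi (Drelators q))).
have piM x y : pi (x * y) = pi x * pi y.
  exact: (rmorphM (aqpi (Drelators q))).
have pi1 : pi 1 = 1 by exact: (rmorph1 (aqpi (Drelators q))).
have pi0 : pi 0 = 0 by exact: (rmorph0 (aqpi (Drelators q))).
have piZ c x : pi (c *: x) = c *: pi x by exact: (linZ pil).
have pig g : pi (gen g) = dgen q g by [].
have piT : pi (tauall k m n) = \prod_j dgen q (Gtau m j).
  exact: (big_morph pi piM pi1).
have R1 x y : Drel q (x * y) 1 -> pi x * pi y = 1.
  by move=> /pi_rel; rewrite piM pi1.
have R2 x y x' y' : Drel q (x * y) (x' * y') -> pi x * pi y = pi x' * pi y'.
  by move=> /pi_rel xy; rewrite -(piM x y) xy (piM x' y').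
have RZ c x y x' y' : Drel q (x * y) (c *: (x' * y')) ->
    pi x * pi y = c *: (pi x' * pi y').
  move=> /pi_rel xy; rewrite -(piM x y) -(piM x' y').
  exact: etrans xy (piZ _ _).
have RJ c x y x' : pi x' * pi x = 1 -> Drel q (x * y * x') (c *: y) ->
    pi x * pi y = c *: (pi y * pi x).
  move=> x'x /pi_rel; rewrite (piM (x * y) x') (piM x y) piZ.
  exact: twist_of_conj.
split.
- by move=> i; exact: (R1 _ _ (rel_sigmaV q i)).
- by move=> i; exact: (R1 _ _ (rel_Vsigma q i)).
- by move=> i; exact: (R1 _ _ (rel_ThetaV q i)).
- by move=> i; exact: (R1 _ _ (rel_VTheta q i)).
- by move=> j; exact: (R1 _ _ (rel_tau_i2 m q j)).
- by rewrite -piT; exact: (R1 _ _ (rel_tau2 m n q)).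
- by move=> i j; exact: (R2 _ _ _ _ (rel_sigmaC q i j)).
- by move=> i j; exact: (R2 _ _ _ _ (rel_tauC m q i j)).
- by move=> i j; exact: (R2 _ _ _ _ (rel_ThetaC q i j)).
- by move=> i j; exact: (R2 _ _ _ _ (rel_sigma_tau q i j)).
- by move=> i j; exact: (R2 _ _ _ _ (rel_sigma_Theta q i j)).
- by move=> i j; exact: (R2 _ _ _ _ (rel_tau_Theta q i j)).
- move=> i i' ii'; have := R2 _ _ _ _ (rel_Theta_root q ii').
  by rewrite piM; case: ifP; rewrite ?piT ?pi1.
- move=> i j; apply: (RJ _ _ _ (gen (GThetaV j))).
    exact: (R1 _ _ (rel_VTheta q j)).
  exact: (rel_Theta_partial q i j).
- move=> i j; apply: (RJ _ _ _ (gen (GsigmaV j))).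
    exact: (R1 _ _ (rel_Vsigma q j)).
  exact: (rel_sigma_partial q i j).
- by move=> i j; exact: (RZ _ _ _ _ _ (rel_tau_partial q i j)).
- by move=> i j; exact: (RZ _ _ _ _ _ (rel_partialC q i j)).
- by move=> j; have /pi_rel := rel_partial2 m q j; rewrite piM pi0.
Qed.

End DqUniversal.

(** * Commutation up to a scalar *)

Section Theta.
Variables (k : fieldType) (m n : nat) (q : k).

Lemma thetaii (i : 'I_(m + n)) : theta q i i = 1.
Proof. by rewrite /theta subrr expr0z. Qed.

Lemma thetaC (i j : 'I_(m + n)) : theta q j i = (theta q i j)^-1.
Proof. by rewrite /theta andbC -opprB invr_expz. Qed.

Lemma theta_neq0 (i j : 'I_(m + n)) : q != 0 -> theta q i j != 0.
Proof.
by move=> q0; rewrite /theta expfz_neq0 //; case: ifP; rewrite ?oppr_eq0.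
Qed.

End Theta.

Section Twist.
Variables (k : fieldType) (A : algType k).
Implicit Types (x y d : A) (c : k).

Definition twist c x d : Prop := x * d = c *: (d * x).

Lemma twistM c c' x y d :
  twist c x d -> twist c' y d -> twist (c * c') (x * y) d.
Proof.
rewrite /twist => xd yd; rewrite -(mulrA x) yd -scalerAr (mulrA x) xd -scalerAl.
by rewrite scalerA mulrC -(mulrA d).
Qed.

Lemma twistZ a c x y : twist c x y -> twist c (a *: x) y.
Proof.
by rewrite /twist -scalerAl => ->; rewrite -scalerAr scalerA mulrC -scalerA.
Qed.

Lemma twistV c x x' d : c != 0 -> x * x' = 1 -> x' * x = 1 ->
  twist c x d -> twist c^-1 x' d.
Proof.
rewrite /twist => c0 xx' x'x xd.
have -> : d * x' = c *: (x' * d).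
  by rewrite -[d in LHS]mul1r -x'x -mulrA -[_ * (d * _)]mulrA (mulrA x) xd
    -scalerAl -(mulrA d) xx' mulr1 -scalerAr.
by rewrite scalerA mulVf // scale1r.
Qed.

Lemma commV x x' y :
  x * x' = 1 -> x' * x = 1 -> x * y = y * x -> x' * y = y * x'.
Proof.
move=> xx' x'x xy; have := @twistV 1 x x' y (oner_neq0 _) xx' x'x.
by rewrite /twist invr1 !scale1r; apply.
Qed.

(** With x d and y e the images of d and e under an antihomomorphism, this is
    the image of the relation d e = c e d; the scalars from moving d past y and
    e past x compensate each other up to the factor c. *)
Lemma antipode_images_commute c x y d e : c != 0 -> x * y = y * x ->
  d * e = c *: (e * d) -> twist c y d -> twist c^-1 x e ->
  (y * e) * (x * d) = c *: ((x * d) * (y * e)).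
Proof.
rewrite /twist => c0 xy de yd xe.
have -> : y * e * (x * d) = c *: (x * y * (e * d)).
  rewrite xy -[LHS]mulrA (mulrA e).
  have -> : e * x = c *: (x * e) by rewrite xe scalerA mulfV // scale1r.
  by rewrite -scalerAl -scalerAr !mulrA.
congr (_ *: _); rewrite -[RHS]mulrA (mulrA d).
have -> : d * y = c^-1 *: (y * d) by rewrite yd scalerA mulVf // scale1r.
by rewrite -scalerAl -(mulrA y) de -!scalerAr scalerA mulVf // scale1r !mulrA.
Qed.

Lemma inverse_unique (x y z : A) : y * x = 1 -> x * z = 1 -> y = z.
Proof. by move=> yx xz; rewrite -[y]mulr1 -xz mulrA yx mul1r. Qed.

(** This transfers a relation x d = c d x, with x grouplike, to coproducts. *)
Lemma tens_twist c x d g h : x * g = g * x -> x * h = h * x -> twist c x d ->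
  tens x x * (tens d g + tens h d) = c *: ((tens d g + tens h d) * tens x x).
Proof.
move=> xg xh xd; rewrite mulrDr mulrDl !tensM xd xg xh tensZl tensZr.
by rewrite scalerDr.
Qed.

(** The outer terms of the two products match by the commutation of the d's, of
    the g's and of the h's, and the two mixed terms are exchanged. *)
Lemma skew_primitives_commute c d1 g1 h1 d2 g2 h2 : c != 0 ->
  d1 * d2 = c *: (d2 * d1) -> g1 * g2 = g2 * g1 -> h1 * h2 = h2 * h1 ->
  twist c^-1 h2 d1 -> twist c h1 d2 -> twist 1 g1 d2 -> twist 1 g2 d1 ->
  (tens d1 g1 + tens h1 d1) * (tens d2 g2 + tens h2 d2) =
    c *: ((tens d2 g2 + tens h2 d2) * (tens d1 g1 + tens h1 d1)).
Proof.
rewrite /twist => c0 dd gg hh h2d h1d; rewrite !scale1r => g1d g2d.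
rewrite !mulrDr !mulrDl !tensM dd gg hh h2d h1d g1d g2d.
rewrite !tensZl !tensZr !scalerDr !scalerA mulfV // scale1r.
exact: addrACA.
Qed.

End Twist.

Lemma prod_converse (k : fieldType) (A : algType k) I (r : seq I) (F : I -> A) :
  (forall i j, F i * F j = F j * F i) ->
  \prod_(i <- r) (F i : A^c) = \prod_(i <- r) F i.
Proof.
move=> FC; elim: r => [|i r IH]; first by rewrite !big_nil.
rewrite !big_cons IH.
rewrite -[LHS]/((\prod_(j <- r) F j) * F i); symmetry.
exact: (commr_prod (P := xpredT) r (fun j _ => FC i j)).
Qed.

(** * The families defining the coproduct, the counit and the antipode *)

Section Families.
Variables (k : fieldType) (m n : nat) (q : k).
Hypothesis q_neq0 : q != 0.
Variables (H : algType k) (f : Dgen m n -> H).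
Hypothesis f_rel : Dq_relations q f.

Let d i : H := f (Gpartial i).
Let T i : H := f (GTheta i).
Let T' i : H := f (GThetaV i).
Let s i : H := f (Gsigma i).
Let s' i : H := f (GsigmaV i).
Let t j : H := f (Gtau m j).

Let TT' i : T i * T' i = 1. Proof. exact: rel_ThetaVr f_rel i. Qed.
Let T'T i : T' i * T i = 1. Proof. exact: rel_ThetaVl f_rel i. Qed.
Let ss' i : s i * s' i = 1. Proof. exact: rel_sigmaVr f_rel i. Qed.
Let s's i : s' i * s i = 1. Proof. exact: rel_sigmaVl f_rel i. Qed.
Let tt j : t j * t j = 1. Proof. exact: rel_tautau f_rel j. Qed.

(** The double commutant of the elements Theta, sigma, tau: a commutative
    subalgebra ([torusC]) that contains their inverses, so that products of any
    of these elements commute without being reordered by hand. *)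
Definition torus x : Prop := forall y,
  (forall i, f (GTheta i) * y = y * f (GTheta i)) ->
  (forall i, f (Gsigma i) * y = y * f (Gsigma i)) ->
  (forall j, f (Gtau m j) * y = y * f (Gtau m j)) -> x * y = y * x.

Lemma torus1 : torus 1.
Proof. by move=> y _ _ _; rewrite mul1r mulr1. Qed.

Lemma torusM x y : torus x -> torus y -> torus (x * y).
Proof.
by move=> Tx Ty z Tz sz tz; rewrite -mulrA Ty // mulrA Tx // mulrA.
Qed.

Lemma torusV x x' : x * x' = 1 -> x' * x = 1 -> torus x -> torus x'.
Proof. by move=> xx' x'x Tx y Ty sy ty; apply: commV xx' x'x _; apply: Tx. Qed.

Lemma torus_Theta i : torus (T i). Proof. by move=> y Ty _ _; exact: Ty. Qed.
Lemma torus_sigma i : torus (s i). Proof. by move=> y _ sy _; exact: sy. Qed.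
Lemma torus_tau i : torus (t i). Proof. by move=> y _ _ ty; exact: ty. Qed.
Lemma torus_ThetaV i : torus (T' i).
Proof. exact: torusV (TT' i) (T'T i) (torus_Theta i). Qed.
Lemma torus_sigmaV i : torus (s' i).
Proof. exact: torusV (ss' i) (s's i) (torus_sigma i). Qed.

Lemma torusC x y : torus x -> torus y -> x * y = y * x.
Proof.
case: f_rel => _ _ _ _ _ _ ss tC TT st sT tT _ _ _ _ _ _.
move=> Tx Ty; apply: Tx => i; symmetry; apply: Ty => j.
- exact: TT.
- exact: sT.
- exact: tT.
- by rewrite sT.
- exact: ss.
- by rewrite st.
- by rewrite tT.
- exact: st.
- exact: tC.
Qed.

Lemma twist_Theta i j : twist (theta q i j) (T j) (d i).
Proof. exact: rel_Theta_d f_rel i j. Qed.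

Lemma twist_ThetaV i j : twist (theta q j i) (T' j) (d i).
Proof.
rewrite thetaC; apply: twistV (TT' j) (T'T j) (twist_Theta i j).
exact: theta_neq0.
Qed.

Lemma twist_sigma i j : i != j -> twist 1 (s j) (d i).
Proof.
move=> /negPf ij; have := rel_sigma_d f_rel i j.
by rewrite ij andbF expr0 expr0 invr1 mulr1.
Qed.

Lemma twist_sigmaV i j : i != j -> twist 1 (s' j) (d i).
Proof.
move=> ij; rewrite -[1]invr1.
by apply: twistV (ss' j) (s's j) (twist_sigma ij); apply: oner_neq0.
Qed.

Lemma twist_tau i j : i != rshift m j -> twist 1 (t j) (d i).
Proof. by move=> /negPf ij; have := rel_tau_d f_rel i j; rewrite ij expr0. Qed.

Lemma twist_tau_self j : twist (-1) (t j) (d (rshift m j)).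
Proof. by have := rel_tau_d f_rel (rshift m j) j; rewrite eqxx expr1. Qed.

(** [right_factor i] and [left_factor i] are the grouplikes g and h in
    Delta d_i = d_i (x) g + h (x) d_i. *)
Definition right_factor i : H :=
  if split i is inl _ then f (GsigmaV i) else 1.
Definition left_unit i : H :=
  match split i with inl _ => f (Gsigma i) | inr j => f (Gtau m j) end.
Definition left_factor i : H := f (GThetaV i) * left_unit i.

Definition coproduct_family (x : Dgen m n) : tensor H H :=
  if x is Gpartial i then
    tens (f x) (right_factor i) + tens (left_factor i) (f x)
  else tens (f x) (f x).

Let g := right_factor.
Let h := left_factor.

Lemma torus_right i : torus (g i).
Proof.
rewrite /g /right_factor.
by case: split => _; [exact: torus_sigmaV|exact: torus1].
Qed.

Lemma torus_left i : torus (h i).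
Proof.
apply: torusM; first exact: torus_ThetaV.
rewrite /left_unit; case: split => *; [exact: torus_sigma|exact: torus_tau].
Qed.

Lemma split_inr i j : split i = inr j -> i = rshift m j :> 'I_(m + n).
Proof. by move=> ij; rewrite -[i]splitK ij. Qed.

Lemma twist_right i j : i != j -> twist 1 (g j) (d i).
Proof.
rewrite /g /right_factor => ij; case: split => _; first exact: twist_sigmaV.
by rewrite /twist mul1r mulr1 scale1r.
Qed.

Lemma twist_left i j : i != j -> twist (theta q j i) (h j) (d i).
Proof.
move=> ij; rewrite -[theta _ _ _]mulr1.
apply: twistM; first exact: twist_ThetaV.
rewrite /left_unit; case E: (split j) => [a|b]; first exact: twist_sigma.
by apply: twist_tau; rewrite -(split_inr E).
Qed.

(** Relations among Theta, sigma and tau pass to the tensor square factor by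
    factor, and [tens_twist] and [skew_primitives_commute] give those with the
    d_i, except that an odd d_j squares to 0 because h d + d h = 0 for its left
    factor h. *)
Lemma coproduct_relations : Dq_relations q coproduct_family.
Proof.
have prodT : \prod_j coproduct_family (Gtau m j) =
    tens (\prod_j t j) (\prod_j t j).
  elim: (index_enum 'I_n) => [|j r IH]; first by rewrite !big_nil tensor1E.
  by rewrite !big_cons IH tensM.
have Dd x i c : torus x -> twist c x (d i) ->
    tens x x * coproduct_family (Gpartial i) =
      c *: (coproduct_family (Gpartial i) * tens x x).
  by move=> Tx xd; apply: tens_twist => //; apply: torusC => //;
    [exact: torus_right|exact: torus_left].
case: (f_rel) => sVr sVl TVr TVl tau2 tp ss tC TT st sT tT rt Td sd td dd d2.
split.
- by move=> i; rewrite tensM sVr.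
- by move=> i; rewrite tensM sVl.
- by move=> i; rewrite tensM TVr.
- by move=> i; rewrite tensM TVl.
- by move=> i; rewrite tensM tau2.
- by rewrite prodT tensM tp.
- by move=> i j; rewrite !tensM ss.
- by move=> i j; rewrite !tensM tC.
- by move=> i j; rewrite !tensM TT.
- by move=> i j; rewrite !tensM st.
- by move=> i j; rewrite !tensM sT.
- by move=> i j; rewrite !tensM tT.
- move=> i i' ii'; rewrite tensM rt // prodT.
  by case: ifP => _; rewrite ?tensor1E !tensM.
- by move=> i j; apply: Dd; [exact: torus_Theta|exact: twist_Theta].
- by move=> i j; apply: Dd; [exact: torus_sigma|exact: sd].
- by move=> i j; apply: Dd; [exact: torus_tau|exact: td].
- move=> i j; have [<-|ij] := eqVneq i j; first by rewrite thetaii scale1r.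
  apply: skew_primitives_commute.
  + exact: theta_neq0.
  + exact: dd.
  + by apply: torusC; exact: torus_right.
  + by apply: torusC; exact: torus_left.
  + by rewrite -thetaC; exact: twist_left.
  + by apply: twist_left; rewrite eq_sym.
  + by apply: twist_right; rewrite eq_sym.
  + exact: twist_right.
- move=> j; rewrite /coproduct_family.
  have -> : right_factor (rshift m j) = 1.
    by rewrite /right_factor (unsplitK (inr j)).
  rewrite mulrDl !mulrDr !tensM d2 tens0l tens0r !mulr1 !mul1r add0r addr0.
  have : twist (- 1) (h (rshift m j)) (d (rshift m j)).
    have := twistM (twist_ThetaV (rshift m j) (rshift m j)) (twist_tau_self j).
    by rewrite thetaii mul1r /h /left_factor /left_unit (unsplitK (inr j)).
  by rewrite /twist /h /d => ->; rewrite tensZl scaleN1r subrr.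
Qed.

Definition antipode_factor i : H :=
  match split i with
  | inl _ => - q *: f (GTheta i)
  | inr j => - (f (GTheta i) * f (Gtau m j))
  end.

(** The values are in the opposite algebra, where S is a homomorphism. *)
Definition antipode_family (x : Dgen m n) : H^c :=
  match x with
  | Gpartial i => antipode_factor i * f (Gpartial i)
  | GTheta i => f (GThetaV i)
  | GThetaV i => f (GTheta i)
  | Gsigma i => f (GsigmaV i)
  | GsigmaV i => f (Gsigma i)
  | Gtau j => f (Gtau m j)
  end.

Let w := antipode_factor.

Lemma torusZ a x : torus x -> torus (a *: x).
Proof. by move=> Tx y Ty sy ty; rewrite -scalerAl Tx // scalerAr. Qed.

Lemma torus_antipode i : torus (w i).
Proof.
rewrite /w /antipode_factor; case: split => [_|j].
  exact/torusZ/torus_Theta.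
rewrite -scaleN1r; apply/torusZ/torusM; first exact: torus_Theta.
exact: torus_tau.
Qed.

Lemma twist_antipode i j : i != j -> twist (theta q i j) (w j) (d i).
Proof.
move=> ij; rewrite /w /antipode_factor; case E: (split j) => [a|b].
  exact/twistZ/twist_Theta.
rewrite -scaleN1r -[theta _ _ _]mulr1.
apply/twistZ/twistM; first exact: twist_Theta.
by apply: twist_tau; rewrite -(split_inr E).
Qed.

(** The image under S of x d_i = c d_i x, with x' = S(x) the inverse of x. *)
Lemma antipode_twist c x x' i :
    torus x' -> c != 0 -> x * x' = 1 -> x' * x = 1 ->
  twist c x (d i) -> (w i * d i) * x' = c *: (x' * (w i * d i)).
Proof.
move=> Tx' c0 xx' x'x xd; have := twistV c0 xx' x'x xd; rewrite /twist => x'd.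
rewrite -mulrA (mulrA x') (torusC Tx' (torus_antipode i)).
rewrite -[in RHS](mulrA (w i)) x'd.
by rewrite -scalerAr scalerA mulfV // scale1r.
Qed.

Lemma antipode_relations : Dq_relations q antipode_family.
Proof.
have cM (x y : H^c) : x * y = (y : H) * (x : H) by [].
case: (f_rel) => sVr sVl TVr TVl tau2 tp ss tC TT st sT tT rt Td sd td dd d2.
have prodT : \prod_j antipode_family (Gtau m j) = \prod_j t j.
  exact: prod_converse.
have Tprod : torus (\prod_j t j).
  apply: big_ind => [|x y|j _]; [exact: torus1|exact: torusM|].
  exact: torus_tau.
split.
- by move=> i; rewrite cM sVr.
- by move=> i; rewrite cM sVl.
- by move=> i; rewrite cM TVr.
- by move=> i; rewrite cM TVl.
- by move=> i; rewrite cM tau2.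
- by rewrite prodT cM tp.
- by move=> i j; rewrite !cM; apply: torusC;
  do ?[exact: torus_tau | exact: torus_ThetaV | exact: torus_sigmaV].
- by move=> i j; rewrite !cM; apply: torusC;
  do ?[exact: torus_tau | exact: torus_ThetaV | exact: torus_sigmaV].
- by move=> i j; rewrite !cM; apply: torusC;
  do ?[exact: torus_tau | exact: torus_ThetaV | exact: torus_sigmaV].
- by move=> i j; rewrite !cM; apply: torusC;
  do ?[exact: torus_tau | exact: torus_ThetaV | exact: torus_sigmaV].
- by move=> i j; rewrite !cM; apply: torusC;
  do ?[exact: torus_tau | exact: torus_ThetaV | exact: torus_sigmaV].
- by move=> i j; rewrite !cM; apply: torusC;
  do ?[exact: torus_tau | exact: torus_ThetaV | exact: torus_sigmaV].
- move=> i i' ii'; rewrite !cM prodT.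
  pose P : H := if i' == m :> nat then \prod_j t j else 1.
  suff: T' i' * T i = s' i' * (s' i * P) by [].
  have PP : P * P = 1 by rewrite /P; case: ifP => _; rewrite ?tp ?mulr1.
  have rt' : T' i * T i' = P * s i * s i' := rt _ _ ii'.
  (* S inverts both sides of T' i * T i' = P * s i * s i', and P is its own
     inverse. *)
  apply: (inverse_unique (x := T' i * T i')).
    by rewrite mulrA -(mulrA (T' i')) TT' mulr1 T'T.
  rewrite rt' -[LHS](mulrA (P * s i)) (mulrA (s i')) ss' mul1r.
  by rewrite (mulrA (P * s i)) -(mulrA P) ss' mulr1.
- move=> i j.
  apply: (antipode_twist (torus_ThetaV j) _ (TVr j) (TVl j) (Td i j)).
  exact: theta_neq0.
- move=> i j.
  apply: (antipode_twist (torus_sigmaV j) _ (sVr j) (sVl j) (sd i j)).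
  by rewrite mulf_neq0 ?signr_eq0 // invr_eq0 expf_neq0.
- move=> i j.
  apply: (antipode_twist (torus_tau j) _ (tau2 j) (tau2 j) (td i j)).
  by rewrite signr_eq0.
- move=> i j; have [<-|ij] := eqVneq i j; first by rewrite thetaii scale1r.
  suff: (w j * d j) * (w i * d i) =
    theta q i j *: ((w i * d i) * (w j * d j)) by [].
  apply: antipode_images_commute.
  + exact: theta_neq0.
  + by apply: torusC; exact: torus_antipode.
  + exact: dd.
  + exact: twist_antipode.
  + by rewrite -thetaC; apply: twist_antipode; rewrite eq_sym.
- move=> j; rewrite cM /= /antipode_factor (unsplitK (inr j)) -scaleN1r.
  have wd := twistZ (-1) (twistM (twist_Theta (rshift m j) (rshift m j))
    (twist_tau_self j)).
  by rewrite {2}wd -scalerAr -mulrA (mulrA (d _)) d2 mul0r mulr0 scaler0.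
Qed.

End Families.

Section Counit.
Variables (k : fieldType) (m n : nat) (q : k).

Definition counit_family (x : Dgen m n) : k^o :=
  if x is Gpartial _ then 0 else 1.

Lemma counit_relations : Dq_relations q counit_family.
Proof.
have prod1 : \prod_(j < n) counit_family (Gtau m j) = 1 by exact: big1.
split; rewrite ?prod1 => *; rewrite ?(mulr0, mul0r, scaler0) // ?mulr1 //.
by case: ifP => _; rewrite ?mulr1.
Qed.

End Counit.

(** * The Hopf structure *)

Section HopfStructure.
Variables (k : fieldType) (m n : nat) (q : k).
Hypothesis q_neq0 : q != 0.
Variables (H : algType k) (f : Dgen m n -> H).
Hypotheses (f_rel : Dq_relations q f) (f_gen : generated_by (range f)).
Variables (D : {lrmorphism H -> tensor H H}) (e : {lrmorphism H -> k^o})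
  (S : {linear H -> H}).
Hypotheses (Df : forall x, D (f x) = coproduct_family f x)
  (ef : forall x, e (f x) = counit_family k x)
  (S1 : S 1 = 1) (SM : forall x y, S (x * y) = S y * S x)
  (Sf : forall x, S (f x) = antipode_family q f x).

Definition torus_gen (x : Dgen m n) : bool :=
  if x is Gpartial _ then false else true.

Lemma grouplike_gen x : torus_gen x ->
  grouplike D e (f x).
Proof. by move=> xG; split; rewrite ?Df ?ef; case: x xG. Qed.

Lemma grouplike_right_factor i : grouplike D e (right_factor f i).
Proof.
rewrite /right_factor; case: split => _; first exact: grouplike_gen.
by split; rewrite rmorph1 ?tensor1E.
Qed.

Lemma grouplike_left_factor i : grouplike D e (left_factor f i).
Proof.
apply: grouplikeM; first exact: grouplike_gen.
by rewrite /left_unit; case: split => *; exact: grouplike_gen.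
Qed.

Lemma gen_pointlike x : range f x -> grouplike D e x \/ skew_primitive D e x.
Proof.
move=> [y _ <-]; have [|] := boolP (torus_gen y).
  by move/grouplike_gen; left.
case: y => // i _; right; exists (right_factor f i), (left_factor f i).
by split; [exact: grouplike_right_factor|exact: grouplike_left_factor
  |rewrite Df|rewrite ef].
Qed.

(** For d_i the identities are S(d) g + S(h) d = 0 and d S(g) + h S(d) = 0. *)
Lemma gen_antipode x : range f x ->
  tlift (fun a b => S a * b) (D x) = (e x : k)%:A /\
  tlift (fun a b => a * S b) (D x) = (e x : k)%:A.
Proof.
case: (f_rel) => sVr sVl TVr TVl tau2 _ _ _ TT st sT tT _ Td sd td _ _.
move=> [y _ <-]; have [|] := boolP (torus_gen y).
  move=> yG; have [-> ->] := grouplike_gen yG.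
  rewrite antipodel_tens antipoder_tens Sf scale1r.
  by case: y yG => //= i _; rewrite ?(sVr, sVl, TVr, TVl, tau2).
case: y => // i _; rewrite Df ef scale0r /=.
rewrite (linD (antipodel_linear S)) (linD (antipoder_linear S)).
rewrite !antipodel_tens !antipoder_tens !Sf /= SM !Sf.
rewrite /right_factor /left_factor /left_unit /antipode_factor.
case E: (split i) => [a|b] /=; rewrite ?Sf ?S1 /=; last first.
  rewrite !mulr1 !mulNr tT addNr; split=> //; rewrite mulrN mulrA.
  have -> : f (GThetaV i) * f (Gtau m b) * (f (GTheta i) * f (Gtau m b)) = 1.
    rewrite -tT -(mulrA (f (GThetaV i))) (mulrA (f (Gtau m b))).
    by rewrite tau2 mul1r TVl.
  by rewrite mul1r subrr.
(* The even case: the factor q in S d = - q T d appears when d passes sigma. *)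
have s_d : twist q^-1 (f (Gsigma i)) (f (Gpartial i)).
  have := sd i i; rewrite -[i]splitK E /= eqxx andbT leqNgt ltn_ord mul1r.
  by rewrite expr1.
have sV_d : twist q (f (GsigmaV i)) (f (Gpartial i)).
  by rewrite -[q]invrK; apply: twistV s_d; rewrite ?invr_eq0.
have sVT : f (GsigmaV i) * f (GTheta i) = f (GTheta i) * f (GsigmaV i).
  exact: commV (sVr i) (sVl i) (sT i i).
split.
  rewrite sVT -[X in _ + X]mulrA sV_d -scalerAr mulrA.
  by rewrite -!scalerAl scaleNr addNr.
rewrite -!scalerAl -scalerAr -(mulrA (f (GThetaV i))) (mulrA (f (Gsigma i))) sT.
rewrite -(mulrA (f (GTheta i))) s_d (mulrA (f (GThetaV i))) TVl mul1r.
by rewrite scalerA mulNr mulfV // scaleN1r subrr.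
Qed.

Theorem Dq_presented_hopf : hopf_algebra D e S.
Proof.
exact: (generated_hopf_algebra f_gen gen_pointlike S1 SM gen_antipode).
Qed.

Theorem Dq_presented_pointed : pointed D.
Proof. exact: (generated_pointed f_gen gen_pointlike). Qed.

End HopfStructure.

Section Antimorphism.
Variables (k : fieldType) (A B : algType k) (F : {lrmorphism A -> B^c}).

Definition antimorphism : A -> B := F.

Lemma antimorphism_linear : linear antimorphism.
Proof. by move=> a x y; exact: (linearP F). Qed.

HB.instance Definition _ :=
  GRing.isLinear.Build k A B *:%R antimorphism antimorphism_linear.

Lemma antimorphism1 : antimorphism 1 = 1.
Proof. exact: (rmorph1 F). Qed.

Lemma antimorphismM x y :
  antimorphism (x * y) = antimorphism y * antimorphism x.
Proof. exact: (rmorphM F). Qed.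

End Antimorphism.

Theorem theorem11 (k : closedFieldType) (k_char0 : [pchar k] =i pred0)
    (q : k) (q_neq0 : q != 0) (q_neq1 : q != 1) (m n : nat) :
  exists (Delta : {lrmorphism Dq m n q -> tensor (Dq m n q) (Dq m n q)})
         (eps : {lrmorphism Dq m n q -> k^o})
         (S : {linear Dq m n q -> Dq m n q}),
    (forall i : 'I_(m + n),
       [/\ Delta (dsigma q i) = tens (dsigma q i) (dsigma q i),
           Delta (dsigmaV q i) = tens (dsigmaV q i) (dsigmaV q i),
           Delta (dTheta q i) = tens (dTheta q i) (dTheta q i) &
           Delta (dThetaV q i) = tens (dThetaV q i) (dThetaV q i)]) /\
    (forall j : 'I_n, Delta (dtau m q j) = tens (dtau m q j) (dtau m q j)) /\
    (forall i0 : 'I_m, let i := lshift n i0 in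
       Delta (dpartial q i) =
         tens (dpartial q i) (dsigmaV q i)
         + tens (dThetaV q i * dsigma q i) (dpartial q i)) /\
    (forall j1 : 'I_n, let j := rshift m j1 in
       Delta (dpartial q j) =
         tens (dpartial q j) 1
         + tens (dThetaV q j * dtau m q j1) (dpartial q j)) /\
    (forall i : 'I_(m + n),
       [/\ eps (dsigma q i) = 1, eps (dsigmaV q i) = 1,
           eps (dTheta q i) = 1, eps (dThetaV q i) = 1 &
           eps (dpartial q i) = 0]) /\
    (forall j : 'I_n, eps (dtau m q j) = 1) /\
    (S 1 = 1 /\ (forall x y, S (x * y) = S y * S x)) /\
    (forall i : 'I_(m + n),
       [/\ S (dsigma q i) = dsigmaV q i, S (dsigmaV q i) = dsigma q i,
           S (dTheta q i) = dThetaV q i & S (dThetaV q i) = dTheta q i]) /\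
    (forall j : 'I_n, S (dtau m q j) = dtau m q j) /\
    (forall i0 : 'I_m, let i := lshift n i0 in
       S (dpartial q i) = - q *: (dTheta q i * dpartial q i)) /\
    (forall j1 : 'I_n, let j := rshift m j1 in
       S (dpartial q j) = - (dTheta q j * dtau m q j1 * dpartial q j)) /\
    hopf_algebra Delta eps S /\
    pointed Delta.
Proof.
have gen_rel := @dgen_relations k m n q.
pose gen : Dgen m n -> Dq m n q := @dgen k m n q.
pose Delta := Dq_lrmorphism (coproduct_relations q_neq0 gen_rel).
pose eps := Dq_lrmorphism (counit_relations m n q).
pose S0 := Dq_lrmorphism (antipode_relations q_neq0 gen_rel).
pose S : {linear Dq m n q -> Dq m n q} := antimorphism S0.
have DE x : Delta (gen x) = coproduct_family gen x.
  exact: (Dq_lift_gen (coproduct_relations q_neq0 gen_rel)).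
have eE x : eps (gen x) = counit_family k x.
  exact: (Dq_lift_gen (counit_relations m n q)).
have SE x : S (gen x) = antipode_family q gen x.
  exact: (Dq_lift_gen (antipode_relations q_neq0 gen_rel)).
have S1 : S 1 = 1 by exact: antimorphism1.
have SM x y : S (x * y) = S y * S x by exact: antimorphismM.
exists Delta, eps, S.
have lP i0 : split (lshift n i0) = inl i0 by exact: (unsplitK (inl i0)).
have rP j1 : split (rshift m j1) = inr j1 by exact: (unsplitK (inr j1)).
split; first by move=> i; split; exact: DE.
split; first by move=> j; exact: DE.
split.
  move=> i0 i; rewrite /i; have := DE (Gpartial (lshift n i0)).
  by rewrite /= /right_factor /left_factor /left_unit lP.
split.
  move=> j1 j; rewrite /j; have := DE (Gpartial (rshift m j1)).
  by rewrite /= /right_factor /left_factor /left_unit rP.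
split; first by move=> i; split; exact: eE.
split; first by move=> j; exact: eE.
split; first by [].
split; first by move=> i; split; exact: SE.
split; first by move=> j; exact: SE.
split.
  move=> i0 i; rewrite /i scalerAl; have := SE (Gpartial (lshift n i0)).
  by rewrite /= /antipode_factor lP.
split.
  move=> j1 j; rewrite /j -mulNr; have := SE (Gpartial (rshift m j1)).
  by rewrite /= /antipode_factor rP.
have gen_generates : generated_by (range gen) := @Dq_generated k m n q.
split.
  exact: (Dq_presented_hopf q_neq0 gen_rel gen_generates DE eE S1 SM SE).
exact: (Dq_presented_pointed gen_generates DE eE).
Qed.
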